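(* Let $q$ be a prime power, $F=\mathbb{F}_{q^m}$, let $I,J$ be distinct integers with $1\leq I,J<m-1$ and $\gcd(I,J,m)=1$, and let $\alpha,\beta,\gamma\in F^*$ be such that the polynomial $$P_{\alpha,\beta,\gamma}^{I,J}(X)=\begin{cases}X^{q^{J-I}+1}+\gamma X-\alpha\beta,&I<J,\\ X^{q^{I-J}+1}+\gamma X^{q^{I-J}}-\alpha\beta,&I>J\end{cases}$$ has no root in $F$. Let $s$ be an integer with $1\leq s<\frac{m-2}{2}$, let $B\leq F$ be an $s$-dimensional $\mathbb{F}_q$-subspace, and let $H_B$, $G_B$ be the matrices defined in the context. Then the columns of $G_B$ span over $\mathbb{F}_q$ an extremal $(m-3)$-scattered $[2m+s,\,2m+s-4]_{q^m/q}$ $q$-system. Let $D_B$ be the $F$-row space of $H_B$. This is the dual of the code associated with the constructed $q$-system, and it is a nondegenerate quasi-MRD code with parameters $[2m+s,4,m-1]_{q^m/q}$. The code associated with the constructed system is a nondegenerate $[2m+s,2m+s-4,2]_{q^m/q}$ quasi-MRD code. If $M:=\max\{I,J\}\leq(m-1)/2$, then $$d_2(D_B)\geq2(m-M)\geq m+1.$$ If, in addition, $$2(m-M)>m+\left\lfloor\frac{s}{2}\right\rfloor,$$ then the system is inequivalent to every $q$-system associated with $D_{(s_1,s_2)}^\perp$, where $s_1+s_2=s$ and $D_{(s_1,s_2)}$ is an order-one direct-sum code. Under the same hypothesis, $D_B$ is not rank-metric equivalent to any nontrivial direct sum.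
   Context: Systems. An $[n,k]_{q^m/q}$ $q$-system is an $n$-dimensional $\mathbb{F}_q$-subspace $U\leq F^k$ with $\langle U\rangle_F=F^k$. It is $h$-scattered if $\dim_{\mathbb{F}_q}(U\cap H)\leq h$ for every $h$-dimensional $F$-subspace $H\leq F^k$, and then extremal if $n=\lfloor km/(h+1)\rfloor$. Two systems in $F^k$ are equivalent if $U'=A(\sigma(U))$ with $A\in\operatorname{GL}(k,F)$, $\sigma\in\operatorname{Aut}(F)$ (full field automorphism group). Codes. An $[n,r]_{q^m/q}$ code is an $r$-dimensional $F$-subspace $C\leq F^n$. The rank weight of $x\in F^n$ is the $\mathbb{F}_q$-dimension of the span of its coordinates; $d(C)$ is the minimum rank weight of a nonzero word, and $[n,r,d]_{q^m/q}$ means $d(C)=d$. $C^\perp=\{y: xy^\top=0\ \forall x\in C\}$. A code is nondegenerate if the columns of a generator matrix are $\mathbb{F}_q$-independent; the $\mathbb{F}_q$-span of the columns is then a $q$-system, and code and system are called associated. For $n>m$, $C$ is quasi-MRD if $m-\lceil mr/n\rceil-d(C)+1=0$. Expanding $x\in F^n$ over an $\mathbb{F}_q$-basis of $F$ as an $m\times n$ matrix, $\operatorname{Rsupp}_q(x)$ is its row space; $\operatorname{Rsupp}_q(V)$ is the sum of supports of an $F$-basis of $V$; $d_i(C)=\min\{\dim_{\mathbb{F}_q}\operatorname{Rsupp}_q(V): V\leq C,\dim_FV=i\}$. Codes $C,C'\leq F^n$ are rank-metric equivalent if $C'=\sigma(C)A$ with $A\in\operatorname{GL}(n,q)$, $\sigma\in\operatorname{Aut}(F)$.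 A nontrivial direct sum is a code $D_1\oplus D_2$ on two disjoint nonempty coordinate blocks with $D_1,D_2$ both of positive dimension. For integers $s_1,s_2\geq0$ with $s_1+s_2=s$, an order-one direct-sum code is $D_{(s_1,s_2)}=D_{s_1}\oplus D_{s_2}$ on disjoint coordinate blocks, where each $D_{s_i}$ is any nondegenerate $[m+s_i,2,m-1]_{q^m/q}$ code. Matrices. Let $\xi_1,\ldots,\xi_m$ be an $\mathbb{F}_q$-basis of $F$ and $b_1,\ldots,b_s$ an $\mathbb{F}_q$-basis of $B$. Define columns in $F^4$ $$c_i=(\xi_i,0,\xi_i^{q^I},\xi_i^{q^J})^\top,\quad d_i=(0,\xi_i,\alpha\xi_i^{q^J},\beta\xi_i^{q^I}+\gamma\xi_i^{q^J})^\top,\quad z_j=(0,0,b_j,0)^\top,$$ and $H_0=[c_1\cdots c_m\ d_1\cdots d_m]$, $Z_B=[z_1\cdots z_s]$, $H_B=[H_0\mid Z_B]$. Choose four columns of $H_0$ forming an invertible $4\times4$ matrix $A$, reorder the columns of $H_B$ so that these come first, write (the reordered matrix) $H_B=[A\ Q]$, and put $G_B=[-Q^\top A^{-\top}\ \ I_{2m+s-4}]$, where $A^{-\top}=(A^{-1})^\top$. *)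

(* Defs.v *)
From HB Require Import structures.
From mathcomp Require Import all_boot all_order all_algebra all_field.
From mathcomp Require Import boolp.

Set Implicit Arguments.
Unset Strict Implicit.
Unset Printing Implicit Defensive.

Import Order.TTheory GRing.Theory Num.Theory.
Local Open Scope ring_scope.

(* Conventions.  K is the field F_q and F, a finite extension of K, is        *)
(* F_(q^m); so m = \dim {:F}.                                                 *)
(* - An F-subspace of F^n (in particular a code) is the row space of a matrix *)
(*   with entries in F, compared by the operators of the scope %MS.           *)
(* - A K-subspace of F^k is a {vspace {ffun 'I_k -> F}}: finite functions     *)
(*   carry the K-vector space structure inherited from F, whereas 'rV[F]_k    *)
(*   canonically carries only the F-structure.                                *)

(* The minimum of a set of natural numbers (0 if the set is empty). *)
Definition min_nat (P : nat -> Prop) : nat :=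
  if pselect (exists n, `[< P n >]) is left exP then ex_minn exP else 0.

Lemma min_natP (P : nat -> Prop) (n : nat) :
  P n -> P (min_nat P) /\ (min_nat P <= n)%N.
Proof.
move=> Pn; rewrite /min_nat; case: pselect => [exP|[]]; last first.
  by exists n; apply/asboolP.
case: ex_minnP => d /asboolP Pd d_min; split=> //.
by apply: d_min; apply/asboolP.
Qed.

Section Systems.

Variables (K : finFieldType) (F : fieldExtType K).

Definition vrow k (v : {ffun 'I_k -> F}) : 'rV[F]_k := \row_i v i.
Definition vcol k (v : {ffun 'I_k -> F}) : 'cV[F]_k := \col_i v i.

Definition qcols k n (G : 'M[F]_(k, n)) : seq {ffun 'I_k -> F} :=
  [seq [ffun i => G i j] | j <- enum 'I_n].

Definition qspan k n (G : 'M[F]_(k, n)) : {vspace {ffun 'I_k -> F}} :=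
  <<qcols G>>%VS.

(* The row space of Fspan U is the F-subspace generated by U. *)
Definition Fspan k (U : {vspace {ffun 'I_k -> F}}) : 'M[F]_(\dim U, k) :=
  \matrix_(i < \dim U) vrow (vbasis U)`_i.

(* The row space of H, as a K-subspace; see mem_resK. *)
Definition resK k r (H : 'M[F]_(r, k)) : {vspace {ffun 'I_k -> F}} :=
  lker (linfun (fun v : {ffun 'I_k -> F} =>
                  [ffun i => (vrow v *m cokermx H) 0 i] : {ffun 'I_k -> F})).

Lemma mem_resK k r (H : 'M[F]_(r, k)) (v : {ffun 'I_k -> F}) :
  (v \in resK H) = (vrow v <= H)%MS.
Proof.
pose f := fun v : {ffun 'I_k -> F} =>
  [ffun i => (vrow v *m cokermx H) 0 i] : {ffun 'I_k -> F}.
have f_lin : linear f.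
  move=> a u w; apply/ffunP => i; rewrite /f !ffunE !mxE scaler_sumr -big_split.
  apply: eq_bigr => j _; rewrite !mxE !ffunE /=.
  by rewrite mulrDl scalerAl.
pose fL : {linear _ -> _} := HB.pack f (GRing.isLinear.Build _ _ _ _ f f_lin).
rewrite /resK memv_ker (lfunE fL) submxE.
apply/eqP/eqP => [/ffunP f0|f0].
  by apply/rowP => i; move: (f0 i); rewrite !ffunE !mxE.
by apply/ffunP => i; rewrite /= /f !ffunE f0 mxE.
Qed.

Definition q_system k (U : {vspace {ffun 'I_k -> F}}) (n : nat) : Prop :=
  \dim U = n /\ row_full (Fspan U).

Definition scattered k (h : nat) (U : {vspace {ffun 'I_k -> F}}) : Prop :=
  forall H : 'M[F]_k, \rank H = h -> (\dim (U :&: resK H) <= h)%N.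

Definition extremal_scattered k (h : nat) (U : {vspace {ffun 'I_k -> F}}) :=
  scattered h U /\ \dim U = ((k * \dim {:F}) %/ h.+1)%N.

(* A field automorphism sigma of F need not be K-linear, so the image of a    *)
(* subspace is described by membership.                                       *)
Definition system_equiv k (U U' : {vspace {ffun 'I_k -> F}}) : Prop :=
  exists (A : 'M[F]_k) (sigma : {rmorphism F -> F}),
    [/\ A \in unitmx, bijective sigma &
        forall v, v \in U' <->
          exists2 u, u \in U & vcol v = A *m map_mx sigma (vcol u)].

End Systems.

Section Codes.

Variables (K : finFieldType) (F : fieldExtType K).

Definition rank_weight n (x : 'rV[F]_n) : nat :=
  \dim <<[seq x (0%R : 'I_1) j | j <- enum 'I_n]>>%VS.

Definition min_dist r n (C : 'M[F]_(r, n)) : nat :=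
  min_nat (fun d => exists x : 'rV[F]_n,
    [/\ (x <= C)%MS, x != 0 & rank_weight x = d]).

Definition code_params r n (C : 'M[F]_(r, n)) (k d : nat) : Prop :=
  \rank C = k /\ min_dist C = d.

Definition dual_code r n (C : 'M[F]_(r, n)) : 'M[F]_n := kermx C^T.

Lemma sub_dualP r n (C : 'M[F]_(r, n)) (y : 'rV[F]_n) :
  reflect (forall x : 'rV[F]_n, (x <= C)%MS -> x *m y^T = 0)
          (y <= dual_code C)%MS.
Proof.
rewrite /dual_code; apply: (iffP sub_kermxP) => [yC x /submxP[u ->]|yC].
  by apply: trmx_inj; rewrite trmx_mul trmxK trmx_mul mulmxA yC mul0mx trmx0.
apply: trmx_inj; rewrite trmx_mul trmxK trmx0; apply/row_matrixP => i.
by rewrite row_mul row0 yC // row_sub.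
Qed.

Definition gen_matrix k r n (G : 'M[F]_(k, n)) (C : 'M[F]_(r, n)) : Prop :=
  row_free G /\ (G == C)%MS.

Definition nondeg_code r n (C : 'M[F]_(r, n)) : Prop :=
  exists2 G : 'M[F]_(\rank C, n), gen_matrix G C & free (qcols G).

Definition associated k r n (C : 'M[F]_(r, n))
    (U : {vspace {ffun 'I_k -> F}}) : Prop :=
  exists G : 'M[F]_(k, n), [/\ gen_matrix G C, free (qcols G) & U = qspan G].

Definition quasi_MRD r n (C : 'M[F]_(r, n)) : Prop :=
  let m := \dim {:F} in
  (m < n)%N /\
  m%:Z - Num.ceil ((m * \rank C)%:R / n%:R : rat) - (min_dist C)%:Z + 1 = 0.

(* Only the row space, which does not depend on the chosen K-basis of F, is   *)
(* relevant.                                                                  *)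
Definition expand_mx n (x : 'rV[F]_n) : 'M[K]_(\dim {:F}, n) :=
  \matrix_(i, j) coord (vbasis {:F}) i (x 0 j).

(* To be used when the rows of V form a basis of its row space. *)
Definition Rsupp i n (V : 'M[F]_(i, n)) : 'M[K]_n :=
  (\sum_(l < i) <<expand_mx (row l V)>>)%MS.

Definition gen_weight r n (i : nat) (C : 'M[F]_(r, n)) : nat :=
  min_nat (fun d => exists V : 'M[F]_(i, n),
    [/\ (V <= C)%MS, row_free V & \rank (Rsupp V) = d]).

Definition code_equiv r r' n (C : 'M[F]_(r, n)) (C' : 'M[F]_(r', n)) : Prop :=
  exists (A : 'M[K]_n) (sigma : {rmorphism F -> F}),
    [/\ A \in unitmx, bijective sigma &
        forall x : 'rV[F]_n, (x <= C')%MS <->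
          exists2 c : 'rV[F]_n, (c <= C)%MS &
            x = map_mx sigma c *m map_mx (in_alg F) A].

(* C = D1 (+) D2; the bijection f identifies the coordinates of C with those  *)
(* of the two blocks, which need not be made of consecutive coordinates.      *)
Definition is_direct_sum r n r1 n1 r2 n2 (C : 'M[F]_(r, n))
    (D1 : 'M[F]_(r1, n1)) (D2 : 'M[F]_(r2, n2)) : Prop :=
  exists2 f : 'I_n -> 'I_(n1 + n2),
    bijective f & (C == colsub f (block_mx D1 0 0 D2))%MS.

Definition nontrivial_direct_sum r n (C : 'M[F]_(r, n)) : Prop :=
  exists (n1 n2 : nat) (D1 : 'M[F]_n1) (D2 : 'M[F]_n2),
    [/\ (0 < n1)%N && (0 < n2)%N, (0 < \rank D1)%N, (0 < \rank D2)%N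
      & is_direct_sum C D1 D2].

Definition order_one_direct_sum r n (s1 s2 : nat) (D : 'M[F]_(r, n)) : Prop :=
  let m := \dim {:F} in
  exists (D1 : 'M[F]_(m + s1)) (D2 : 'M[F]_(m + s2)),
    [/\ nondeg_code D1 /\ code_params D1 2 (m - 1),
        nondeg_code D2 /\ code_params D2 2 (m - 1)
      & is_direct_sum D D1 D2].

End Codes.

Section Construction.

Variables (K : finFieldType) (F : fieldExtType K).

Definition P_poly (q I J : nat) (alpha beta gamma : F) : {poly F} :=
  if (I < J)%N
  then 'X^(q ^ (J - I) + 1) + gamma *: 'X - (alpha * beta)%:P
  else 'X^(q ^ (I - J) + 1) + gamma *: 'X^(q ^ (I - J)) - (alpha * beta)%:P.

Definition H0_mx (q I J : nat) (alpha beta gamma : F) m (xi : m.-tuple F) :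
    'M[F]_(4, m + m) :=
  row_mx
    (\matrix_(i < 4, j < m) let x := tnth xi j in
       [:: x; 0; x ^+ (q ^ I); x ^+ (q ^ J)]`_i)
    (\matrix_(i < 4, j < m) let x := tnth xi j in
       [:: 0; x; alpha * x ^+ (q ^ J);
           beta * x ^+ (q ^ I) + gamma * x ^+ (q ^ J)]`_i).

Definition Z_mx s (b : s.-tuple F) : 'M[F]_(4, s) :=
  \matrix_(i < 4, j < s) [:: 0; 0; tnth b j; 0]`_i.

Definition HB_mx (q I J : nat) (alpha beta gamma : F)
    m (xi : m.-tuple F) s (b : s.-tuple F) : 'M[F]_(4, m + m + s) :=
  row_mx (H0_mx q I J alpha beta gamma xi) (Z_mx b).

(* The column reordering p brings first four columns of the left block H0 of  *)
(* [H0 Z], and these form an invertible matrix.                               *)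
Definition admissible_reordering n0 s k (H : 'M[F]_(4, n0 + s))
    (p : 'I_(4 + k) -> 'I_(n0 + s)) : Prop :=
  [/\ bijective p, forall j : 'I_4, (p (lshift k j) < n0)%N
    & lsubmx (colsub p H) \in unitmx].

(* For H = [A Q], the matrix [- Q^T A^-T  I]. *)
Definition GB_mx k (H : 'M[F]_(4, 4 + k)) : 'M[F]_(k, 4 + k) :=
  let A := lsubmx H in
  let Q := rsubmx H in
  row_mx (- (Q^T *m (invmx A)^T)) 1%:M.

End Construction.

(* Main.v *)
Require Import Defs.
From HB Require Import structures.
From mathcomp Require Import all_boot all_order all_algebra all_field.
From mathcomp Require Import zify ring.

Set Implicit Arguments.
Unset Strict Implicit.
Unset Printing Implicit Defensive.

Import Order.TTheory GRing.Theory Num.Theory.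
Local Open Scope ring_scope.

(** Write n = 2m + s. Everything reduces to two lower bounds on supports in the
    code D_B, and to elementary counting.

    Minimum distance. The entries of the word u H_0 are the values on a basis of
    F of two linearized polynomials with exponents 0, I, J. If they spanned a
    subspace of codimension at least 2, two K-independent elements z and w would
    be orthogonal to both images for the trace form (trace_annihilator). The
    adjoint equations for z and w, together with gcd(I, J, m) = 1, then give an
    equation in the last two entries of u whose only solution is 0, because P has
    no root in F (no_independent_annihilators, noroot_adjoint). So all nonzero
    words have weight at least m - 1 (supp_H0), and appending the columns of Z_B
    cannot lower a weight. Conversely, a code of K-dimension 4m > n has a word
    whose entries lie in a hyperplane of F (singleton_word).

    Scatteredness. A K-subspace of dimension m - 2 of the system spanned by the
    columns of G_B that lay in an F-subspace of dimension m - 3 would give a word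
    of weight at most m - 2 in the dual code, which is D_B (scattered_from_dual).
    The parameters of the code of the system follow in the same way: weight 1 is
    impossible as the columns of H_B are independent over K, and weight 2 occurs
    by counting (dual_min_dist).

    Second weight. The support of a plane in D_B has dimension n minus the
    dimension of the K-space of solutions of two equations in (x, y, b). Leaving
    out b costs at most s, so it suffices to bound the solutions (x, y) of two
    linearized equations of q-degree at most M = max(I, J) by 2M (pair_bound).
    If the matrix of the twisted coefficients is invertible, this is a Bezout-type
    count, obtained from the fact that the relations between the vectors of the
    first M Frobenius images of x and y descend to K (frobenius_descent). If it is
    singular, the solutions lie on an F-line, on which a nonzero trinomial of
    q-degree at most M vanishes.

    Inequivalence. Supports are invariant under rank-metric equivalence. In a
    direct sum equivalent to D_B the blocks cannot have dimensions 1 and 3, by the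
    Singleton bound, and if they have dimensions 2 and 2, the shorter one supports
    a plane in at most m + s/2 coordinates, against the second weight
    (no_direct_sum). An equivalence of systems induces one of the dual codes
    (system_equiv_code_equiv), so the statement on systems follows. *)

(* The rows of H_0 are indexed by ord0, o1, o2 and o3. *)
Local Notation o1 := (@Ordinal 4 1 isT).
Local Notation o2 := (@Ordinal 4 2 isT).
Local Notation o3 := (@Ordinal 4 3 isT).

(** * The Frobenius maps and the trace form *)

Section Frobenius.

Variables (K : finFieldType) (F : fieldExtType K).
Local Notation q := #|K|.
Local Notation m := (\dim {:F}).

Definition frob (i : nat) (x : F) : F := x ^+ (q ^ i).

Lemma pchar_nat_card : [pchar F].-nat q.
Proof.
have [p p_pr pK] := finPcharP K.
have pF : p \in [pchar F] by rewrite (fmorph_pchar (in_alg F)).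
rewrite (eq_pnat _ (pcharf_eq pF)) -cardsT.
exact: (@pprimeChar_pgroup p K pK).
Qed.

Lemma frobD i : {morph frob i : x y / x + y}.
Proof. by move=> x y; rewrite /frob exprDn_pchar // pnatX pchar_nat_card. Qed.

Lemma frobM i : {morph frob i : x y / x * y}.
Proof. by move=> x y; rewrite /frob exprMn. Qed.

Lemma card_exp_gt0 i : (0 < q ^ i)%N.
Proof. by rewrite expn_gt0 (ltnW (finNzRing_gt1 K)). Qed.

Lemma frob0 i : frob i 0 = 0.
Proof. by rewrite /frob expr0n gtn_eqF // card_exp_gt0. Qed.

Lemma frobN i : {morph frob i : x / - x}.
Proof.
by move=> x; apply/eqP; rewrite -subr_eq0 opprK -frobD addNr frob0.
Qed.

Fact frob_zmod_morphism i : zmod_morphism (frob i).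
Proof. by move=> x y; rewrite frobD frobN. Qed.

Fact frob_monoid_morphism i : monoid_morphism (frob i).
Proof. by split; [rewrite /frob expr1n | apply: frobM]. Qed.

HB.instance Definition _ i :=
  GRing.isZmodMorphism.Build F F (frob i) (frob_zmod_morphism i).
HB.instance Definition _ i :=
  GRing.isMonoidMorphism.Build F F (frob i) (frob_monoid_morphism i).

Lemma frob_comp i j x : frob i (frob j x) = frob (i + j) x.
Proof. by rewrite /frob -exprM -expnD addnC. Qed.

Lemma frob_dim x : frob m x = x.
Proof. by apply/eqP; rewrite -Fermat's_little_theorem memvf. Qed.

Lemma frob1_fixed x : frob 1 x = x -> exists a : K, x = in_alg F a.
Proof.
rewrite /frob expn1 => /eqP xq.
have : x \in 1%VS by rewrite (@Fermat's_little_theorem K F 1%AS) dimv1 expn1.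
by move/vlineP => [a ->]; exists a.
Qed.

Lemma frob_in_alg i (a : K) : frob i (in_alg F a) = in_alg F a.
Proof.
rewrite /frob -rmorphXn; congr (in_alg F _).
by elim: i => [|i IH]; rewrite ?expr1 // expnS exprM expf_card.
Qed.

Lemma frobZ i (a : K) x : frob i (a *: x) = a *: frob i x.
Proof. by rewrite -mulr_algl frobM frob_in_alg mulr_algl. Qed.

Lemma frob_inj i : injective (frob i).
Proof. exact: fmorph_inj. Qed.

Lemma frobK i x : (i <= m)%N -> frob (m - i) (frob i x) = x.
Proof. by move=> le_im; rewrite frob_comp subnK // frob_dim. Qed.

Lemma frobKV i x : (i <= m)%N -> frob i (frob (m - i) x) = x.
Proof. by move=> le_im; rewrite frob_comp subnKC // frob_dim. Qed.

Lemma frob_fixed_mul i j x : frob i x = x -> frob (i * j) x = x.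
Proof.
move=> fx; elim: j => [|j IH]; first by rewrite muln0 /frob expr1.
by rewrite mulnS -frob_comp IH.
Qed.

Lemma frob_fixed_gcd i j x :
  frob i x = x -> frob j x = x -> frob (gcdn i j) x = x.
Proof.
case: (posnP i) => [-> |i_gt0] fi fj; first by rewrite gcd0n.
case: (egcdnP j i_gt0) => u v uv _.
by rewrite -{1}(frob_fixed_mul v fj) frob_comp addnC (mulnC j) -uv mulnC
           frob_fixed_mul.
Qed.

(** The hypothesis on the greatest common divisor of I, J and m enters only
    here: the indices i whose Frobenius map fixes x are closed under gcd, and m
    is one of them, so that x is fixed by the generator of the Galois group. *)
Lemma frob_fixed_coprime i j x : gcdn (gcdn i j) m = 1%N ->
  frob i x = x -> frob j x = x -> exists a : K, x = in_alg F a.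
Proof.
move=> g1 fi fj; apply: frob1_fixed; rewrite -g1.
by apply: frob_fixed_gcd (frob_dim x); apply: frob_fixed_gcd.
Qed.

Definition tr (x : F) : F := \sum_(i < m) frob i x.

Fact tr_linear : linear tr.
Proof.
move=> a x y; rewrite /tr scaler_sumr -big_split; apply: eq_bigr => i _.
by rewrite frobD frobZ.
Qed.

HB.instance Definition _ := GRing.isLinear.Build K F F _ tr tr_linear.

Lemma dim_gt0 : (0 < m)%N.
Proof. exact: adim_gt0. Qed.

Lemma frob1_tr x : frob 1 (tr x) = tr x.
Proof.
rewrite /tr rmorph_sum /=.
under eq_bigr do rewrite frob_comp add1n.
case Em: m dim_gt0 (frob_dim x) => [//|n] _ fn.
by rewrite big_ord_recr /= fn [RHS]big_ord_recl /= addrC {2}/frob expr1.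
Qed.

Lemma tr_in_alg x : exists a : K, tr x = in_alg F a.
Proof. exact/frob1_fixed/frob1_tr. Qed.

Lemma tr_frob i x : tr (frob i x) = tr x.
Proof.
have -> : tr (frob i x) = frob i (tr x).
  rewrite /tr rmorph_sum /=; apply: eq_bigr => j _.
  by rewrite !frob_comp addnC.
by have [a ->] := tr_in_alg x; rewrite frob_in_alg.
Qed.

(** The trace is a polynomial function of degree q ^ (m - 1), too small to vanish
    on the q ^ m elements of F. *)
Lemma tr_neq0 : exists x, tr x != 0.
Proof.
case Em: m dim_gt0 => [//|n] _.
pose p : {poly F} := \sum_(i < n.+1) 'X^(q ^ i).
have pE x : p.[x] = tr x.
  by rewrite /tr Em horner_sum; apply: eq_bigr => i _; rewrite hornerXn.
have size_p : size p = (q ^ n).+1.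
  rewrite /p big_ord_recr /= addrC size_polyDl size_polyXn // ltnS.
  apply: (leq_trans (size_sum _ _ _)); apply/bigmax_leqP => i _.
  by rewrite size_polyXn ltn_exp2l // finNzRing_gt1.
have p_neq0 : p != 0 by rewrite -size_poly_eq0 size_p.
have size_F : size (enum (finvect_type F)) = (q ^ n.+1)%N.
  by rewrite -cardE -(card_vspacef (Vector.class (finvect_type F))) card_vspace Em.
case: (pickP (fun x : finvect_type F => tr x != 0)) => [x|tr0]; first by exists x.
have all_p : all (root p) (enum (finvect_type F)).
  by apply/allP => x _; rewrite /root pE; have /negbFE := tr0 x.
have := max_poly_roots p_neq0 all_p (enum_uniq (finvect_type F)).
by rewrite size_F size_p ltnS leqNgt ltn_exp2l ?finNzRing_gt1 // ltnSn.
Qed.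

Lemma tr_nondeg z : (forall x, tr (z * x) = 0) -> z = 0.
Proof.
move=> z0; apply/eqP/negPn/negP => z_neq0; have [x /negP[]] := tr_neq0.
by rewrite -[x](mulVKf z_neq0) z0.
Qed.

(** Frobenius maps are isometries of the trace form, so the adjoint of
    x |-> u * frob i x is z |-> frob (m - i) (u * z). *)
Lemma tr_adjoint i u z x : (i <= m)%N ->
  tr (z * (u * frob i x)) = tr (frob (m - i) (u * z) * x).
Proof.
move=> le_im; rewrite -(tr_frob (m - i)) !frobM frobK //.
by rewrite mulrCA mulrA.
Qed.

(** The trace with its values in the base field, where it can be used as a
    coordinate: 1 spans the image of K in F. *)
Definition trK (x : F) : K := coord [tuple (1%R : F)] ord0 (tr x).

Lemma trK_linear a x y : trK (a *: x + y) = a * trK x + trK y.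
Proof. by rewrite /trK !linearP. Qed.

Lemma trKE x : tr x = in_alg F (trK x).
Proof.
have [a xE] := tr_in_alg x.
have : tr x \in <<[tuple (1%R : F)]>>%VS.
  by rewrite span_seq1 xE; apply/vlineP; exists a.
by move/coord_span => {1}->; rewrite big_ord1.
Qed.

End Frobenius.

(** * Rank supports *)

Section Support.

Variables (K : finFieldType) (F : fieldExtType K).
Local Notation toF := (map_mx (in_alg F)).

Lemma mulmx_inalgE n l (x : 'rV[F]_n) (N : 'M[K]_(n, l)) j :
  (x *m toF N) 0 j = \sum_i N i j *: x 0 i.
Proof. by rewrite mxE; apply: eq_bigr => i _; rewrite mxE mulrC mulr_algl. Qed.

Lemma expand_mxM n l (x : 'rV[F]_n) (N : 'M[K]_(n, l)) :
  expand_mx (x *m toF N) = expand_mx x *m N.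
Proof.
apply/matrixP => i j; rewrite [LHS]mxE mulmx_inalgE linear_sum mxE /=.
by apply: eq_bigr => k _; rewrite linearZ mxE /= mulrC.
Qed.

Lemma expand_mx_eq0 n (x : 'rV[F]_n) : (expand_mx x == 0) = (x == 0).
Proof.
apply/eqP/eqP => [x0|->]; last by apply/matrixP => i j; rewrite !mxE linear0.
apply/rowP => j; rewrite mxE (coord_vbasis (memvf (x 0 j))).
rewrite big1 // => i _; move/matrixP/(_ i j): x0.
by rewrite !mxE => ->; rewrite scale0r.
Qed.

(** This description of the annihilator of a support does not mention the basis
    of F used to expand the entries, which makes it computable on generator
    matrices and comparable across field automorphisms. *)
Lemma Rsupp_mul_eq0 i n l (V : 'M[F]_(i, n)) (N : 'M[K]_(n, l)) :
  (Rsupp V *m N == 0) = (V *m toF N == 0).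
Proof.
rewrite -sub_kermx; apply/sumsmx_subP/eqP => [VN|VN j _].
  apply/row_matrixP => j; rewrite row_mul row0; apply/eqP.
  rewrite -expand_mx_eq0 expand_mxM -sub_kermx.
  by apply: submx_trans (VN j isT); rewrite genmxE.
rewrite genmxE sub_kermx -expand_mxM expand_mx_eq0 -row_mul VN.
by rewrite row0.
Qed.

Definition supp i n (V : 'M[F]_(i, n)) := \rank (Rsupp V).

Lemma supp0 i n : supp (0 : 'M[F]_(i, n)) = 0%N.
Proof.
apply/eqP; rewrite mxrank_eq0 -[Rsupp _]mulmx1.
by rewrite Rsupp_mul_eq0 mul0mx.
Qed.

(** Rank-nullity in the form used to bound supports from below: a bound on the
    number of independent K-relations between the columns of V is a bound on its
    support. *)
Lemma supp_ker i n (V : 'M[F]_(i, n)) :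
  exists N : 'M[K]_(n - supp V, n), row_free N /\ V *m toF N^T = 0.
Proof.
have rkN : \rank (kermx (Rsupp V)^T) = (n - supp V)%N by rewrite mxrank_ker mxrank_tr.
rewrite -rkN; exists (row_base (kermx (Rsupp V)^T)); split.
  exact: row_base_free.
apply/eqP; rewrite -Rsupp_mul_eq0; apply/eqP/trmx_inj.
by rewrite trmx_mul trmx0 trmxK; apply/sub_kermxP; rewrite eq_row_base.
Qed.

Lemma supp_bound i n r (V : 'M[F]_(i, n)) (N : 'M[K]_(r, n)) :
  row_free N -> V *m toF N^T = 0 -> (supp V <= n - r)%N.
Proof.
move=> /eqP rkN /eqP; rewrite -Rsupp_mul_eq0 => /eqP VN.
have /mxrankS : (N <= kermx (Rsupp V)^T)%MS.
  by apply/sub_kermxP/trmx_inj; rewrite trmx_mul !trmxK trmx0.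
rewrite rkN mxrank_ker mxrank_tr -/(supp V).
have := rank_leq_col (Rsupp V); rewrite -/(supp V); lia.
Qed.

Lemma supp_leq i n (V : 'M[F]_(i, n)) : (supp V <= n)%N.
Proof. exact: rank_leq_col. Qed.

(** Applied to E and to an inverse of E, this gives the invariance of supports
    under reorderings of the coordinates and changes of K-basis. *)
Lemma supp_mulK i n l (V : 'M[F]_(i, n)) (E : 'M[K]_(n, l)) :
  (supp (V *m toF E) <= supp V)%N.
Proof.
apply: leq_trans (mxrankM_maxl _ E).
apply/mxrankS/sumsmx_subP => j _.
rewrite genmxE row_mul expand_mxM; apply: submxMr.
by apply: (sumsmx_sup j) => //; rewrite genmxE.
Qed.

Lemma rank_weight_mulK n d (y : 'rV[F]_d) (T : 'M[K]_(d, n)) :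
  (rank_weight (y *m toF T) <= d)%N.
Proof.
pose Y := [seq y 0 j | j <- enum 'I_d].
apply: leq_trans (_ : \dim <<Y>> <= _)%N; last first.
  by apply: leq_trans (dim_span _) _; rewrite size_map size_enum_ord.
apply/dimvS/span_subvP => _ /mapP[j _ ->]; rewrite mulmx_inalgE.
apply: memv_suml => i _; apply/memvZ/memv_span.
by apply/mapP; exists i; rewrite ?mem_enum.
Qed.

(** The rank factorization over K of the expansion of x, read back in F. *)
Lemma expand_factor n (x : 'rV[F]_n) :
  exists y, x = y *m toF (row_base (expand_mx x)).
Proof.
pose R := row_base (expand_mx x); pose C := col_base (expand_mx x).
pose y := \row_l \sum_i C i l *: (vbasis {:F})`_i : 'rV[F]__.
exists y; apply/rowP => j; rewrite mulmx_inalgE (coord_vbasis (memvf (x 0 j))).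
under [RHS]eq_bigr do rewrite [y _ _]mxE scaler_sumr.
rewrite exchange_big; apply: eq_bigr => i _ /=.
have /matrixP/(_ i j) : expand_mx x = C *m R by rewrite mulmx_base.
rewrite !mxE => ->; rewrite scaler_suml; apply: eq_bigr => l _.
by rewrite scalerA mulrC.
Qed.

Lemma supp_rowE n (x : 'rV[F]_n) : supp x = \rank (expand_mx x).
Proof.
rewrite /supp /Rsupp big_ord1 genmxE; congr (\rank (expand_mx _)).
by apply/rowP => j; rewrite mxE.
Qed.

Lemma rank_weightE n (x : 'rV[F]_n) : rank_weight x = supp x.
Proof.
apply/eqP; rewrite eqn_leq; apply/andP; split.
  have [y xE] := expand_factor x.
  by rewrite supp_rowE {1}xE; apply: rank_weight_mulK.
rewrite /rank_weight; set X := [seq _ | _ <- _].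
pose y := \row_i (vbasis <<X>>)`_i : 'rV[F]_(\dim <<X>>).
pose T := \matrix_(i, j) coord (vbasis <<X>>) i (x 0 j).
suff -> : x = y *m toF T by apply: leq_trans (supp_mulK _ _) (supp_leq _).
apply/rowP => j; rewrite mulmx_inalgE.
have xX : x 0 j \in <<X>>%VS by apply/memv_span/mapP; exists j; rewrite ?mem_enum.
by rewrite {1}(coord_vbasis xX); apply: eq_bigr => i _; rewrite !mxE.
Qed.

End Support.

(** * A Singleton-type bound *)

Section Singleton.

Variables (K : finFieldType) (F : fieldExtType K).
Local Notation toF := (map_mx (in_alg F)).
Local Notation m := (\dim {:F}).

(** A dimension count over K: requiring the last m - t coordinates of every entry
    to vanish imposes (m - t) * n linear conditions on a space of dimension m times
    the dimension of C, and the entries of a word that meets them all lie in a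
    t-dimensional subspace of F. *)
Lemma singleton_word r n t (C : 'M[F]_(r, n)) : (t <= m)%N ->
  ((m - t) * n < \rank C * m)%N ->
  exists x : 'rV[F]_n, [/\ (x <= C)%MS, x != 0 & (supp x <= t)%N].
Proof.
move=> le_tm lt_nC; pose e := vbasis {:F}.
have h_lt (i : 'I_(m - t)) : (t + i < m)%N by rewrite -ltn_subRL.
pose h i := Ordinal (h_lt i).
pose G := row_base C; pose word (a : 'M[K]_(\rank C, m)) : 'rV[F]_n :=
  (\row_i \sum_l a i l *: e`_l) *m G.
pose f (a : 'M[K]_(\rank C, m)) : 'M[K]_(m - t, n) :=
  \matrix_(i, j) \sum_k \sum_l a k l * coord e (h i) (e`_l * G k j).
have f_lin : linear f.
  move=> c a b; apply/matrixP => i j; rewrite !mxE mulr_sumr -big_split.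
  apply: eq_bigr => k _; rewrite mulr_sumr -big_split; apply: eq_bigr => l _.
  by rewrite !mxE mulrDl mulrA.
have fE a i j : f a i j = expand_mx (word a) (h i) j.
  rewrite !mxE linear_sum; apply: eq_bigr => k _ /=.
  rewrite mxE mulr_suml linear_sum; apply: eq_bigr => l _ /=.
  by rewrite -scalerAl linearZ.
pose fL : {linear _ -> _} := HB.pack f (GRing.isLinear.Build _ _ _ _ f f_lin).
have [a a_neq0 fa] : exists2 a, a != 0 & f a = 0.
  have : lker (linfun fL) != 0%VS.
    have le_im : (\dim (limg (linfun fL)) <= (m - t) * n)%N.
      by apply: leq_trans (dimvS (subvf _)) _; rewrite dimvf.
    have := limg_ker_dim (linfun fL) fullv; rewrite capfv -dimv_eq0.
    have -> : (\dim (fullv : {vspace 'M[K]_(\rank C, m)}) = \rank C * m)%N.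
      by rewrite dimvf.
    by move=> rk; apply: contraTneq lt_nC => k0; rewrite -leqNgt -rk k0.
  rewrite -vpick0 => a_neq0; exists (vpick (lker (linfun fL))) => //.
  by have := memv_pick (lker (linfun fL)); rewrite memv_ker lfunE => /eqP.
exists (word a); split.
- by rewrite (submx_trans (submxMl _ _)) // eq_row_base.
- apply: contra_neq a_neq0 => /eqP.
  rewrite mulmx_free_eq0 ?row_base_free // => /eqP c0.
  apply/matrixP => i l; rewrite mxE.
  have e_free : free e := basis_free (vbasisP _).
  move/rowP/(_ i): c0; rewrite !mxE => /(freeP e_free)/(_ l) //.
- rewrite supp_rowE.
  have /mxrankS : (expand_mx (word a) <=
      rowsub (widen_ord le_tm) (expand_mx (word a)))%MS.
    apply/row_subP => i; case: (ltnP i t) => [lt_it|le_ti].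
      have -> : i = widen_ord le_tm (Ordinal lt_it) by apply/val_inj.
      by rewrite -row_rowsub row_sub.
    have lt_i : (i - t < m - t)%N by rewrite ltn_sub2r // (leq_ltn_trans le_ti).
    have -> : i = h (Ordinal lt_i) by apply/val_inj; rewrite /= subnKC.
    rewrite (_ : row _ _ = 0) ?sub0mx //; apply/rowP => j.
    by rewrite mxE -fE fa !mxE.
  by move/leq_trans; apply; apply: rank_leq_row.
Qed.

End Singleton.

(** * Supports under field automorphisms *)

Section FieldAutomorphism.

Variables (K : finFieldType) (F : fieldExtType K).
Variables (sigma : {rmorphism F -> F}) (sigma_bij : bijective sigma).
Local Notation toF := (map_mx (in_alg F)).

Lemma rmorph_frob i x : sigma (frob i x) = frob i (sigma x).
Proof. exact: rmorphXn. Qed.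

Lemma rmorph_toF r n (N : 'M[K]_(r, n)) :
  exists N' : 'M[K]_(r, n), map_mx sigma (toF N) = toF N'.
Proof.
have ex (a : K) : exists b : K, sigma (in_alg F a) == in_alg F b.
  have [|b ->] := @frob1_fixed K F (sigma (in_alg F a)); last by exists b.
  by rewrite -rmorph_frob frob_in_alg.
exists (map_mx (fun a => xchoose (ex a)) N); apply/matrixP => i j; rewrite !mxE.
exact/eqP/(xchooseP (ex _)).
Qed.

(** An automorphism of F commutes with the q-th power, hence permutes the image
    of K, which is the fixed field of that power. *)
Lemma rmorph_toFV r n (N : 'M[K]_(r, n)) :
  exists N' : 'M[K]_(r, n), map_mx sigma (toF N') = toF N.
Proof.
have ex (a : K) : exists b : K, sigma (in_alg F b) == in_alg F a.
  have [tau _ sK] := sigma_bij.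
  have [|b bE] := @frob1_fixed K F (tau (in_alg F a)).
    by apply: (bij_inj sigma_bij); rewrite rmorph_frob sK frob_in_alg.
  by exists b; rewrite -bE sK.
exists (map_mx (fun a => xchoose (ex a)) N); apply/matrixP => i j; rewrite !mxE.
exact/eqP/(xchooseP (ex _)).
Qed.

Lemma supp_rmorph i n (V : 'M[F]_(i, n)) : (supp V <= supp (map_mx sigma V))%N.
Proof.
have [N [N_free VN]] := supp_ker (map_mx sigma V).
have [N' NE] := rmorph_toFV N.
have N'_free : row_free N'.
  by rewrite /row_free -(mxrank_map (in_alg F)) -(mxrank_map sigma) NE mxrank_map.
have := supp_leq (map_mx sigma V).
have := @supp_bound _ _ _ _ _ V _ N'_free; have ->: V *m toF N'^T = 0.
  apply: (map_mx_inj (f := sigma)).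
  by rewrite map_mxM map_mx0 -!map_trmx NE map_trmx VN.
move/(_ (erefl _)); lia.
Qed.

End FieldAutomorphism.

(** * Consequences of the absence of roots *)

Section NoRoot.

Variables (K : finFieldType) (F : fieldExtType K) (I J : nat).
Variables (alpha beta gamma : F).
Local Notation frob := (@frob K F).
Hypotheses (neq_IJ : I <> J) (alpha_neq0 : alpha != 0) (beta_neq0 : beta != 0).
Hypothesis P_noroot : forall x, ~~ root (P_poly #|K| I J alpha beta gamma) x.

Lemma noroot_lt x : (I < J)%N ->
  frob (J - I) x * x + gamma * x - alpha * beta != 0.
Proof.
move=> lt_IJ; have := P_noroot x; rewrite /P_poly lt_IJ /root !hornerE.
by rewrite addn1 exprSr.
Qed.

Lemma noroot_gt x : (J < I)%N ->
  frob (I - J) x * x + gamma * frob (I - J) x - alpha * beta != 0.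
Proof.
move=> lt_JI; have := P_noroot x; rewrite /P_poly ltnNge (ltnW lt_JI) /root !hornerE.
by rewrite addn1 exprSr.
Qed.

(** Up to the substitution x = t * y and a Frobenius map, the equation says that
    a power of t is a root of P. *)
Lemma noroot_line x y :
  frob I x * (frob J x + gamma * frob J y) = alpha * beta * (frob I y * frob J y) ->
  x = 0 /\ y = 0.
Proof.
have [-> | y_neq0] := eqVneq y 0.
  rewrite !raddf0 /= !mulr0 addr0 => /eqP; rewrite mulf_eq0 !fmorph_eq0 orbb.
  by move/eqP.
have [t ->] : exists t, x = t * y by exists (x / y); rewrite divfK.
rewrite !rmorphM /= => e; exfalso.
have {e} e : frob I t * (frob J t + gamma) = alpha * beta.
  have ne : frob I y * frob J y != 0 by rewrite mulf_neq0 // fmorph_eq0.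
  by apply: (mulIf ne); rewrite -e; ring.
case: (ltngtP I J) => // lt. 
  have /negP[] := noroot_lt (frob I t) lt.
  rewrite frob_comp subnK ?(ltnW lt) // subr_eq0 -e; apply/eqP; ring.
have /negP[] := noroot_gt (frob J t) lt.
by rewrite frob_comp subnK ?(ltnW lt) // subr_eq0 -e; apply/eqP; ring.
Qed.

(** The analogue of noroot_line for the adjoint equations: with x = t * y, the
    root of P would be - beta / t when I < J, and - (alpha * t + gamma) when
    J < I. *)
Lemma noroot_adjoint x y :
  frob J x * frob I (alpha * x + gamma * y) = frob I y * frob J (beta * y) ->
  x = 0 /\ y = 0.
Proof.
have [-> | y_neq0] := eqVneq y 0.
  rewrite !mulr0 addr0 !raddf0 /= mul0r => /eqP.
  by rewrite mulf_eq0 !fmorph_eq0 mulf_eq0 (negPf alpha_neq0) orbb => /eqP.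
have [t ->] : exists t, x = t * y by exists (x / y); rewrite divfK.
rewrite mulrA -mulrDl !rmorphM /= => e; exfalso.
have {e} e : frob J t * frob I (alpha * t + gamma) = frob J beta.
  have ne : frob I y * frob J y != 0 by rewrite mulf_neq0 // fmorph_eq0.
  by apply: (mulIf ne); rewrite [RHS]mulrCA -e; ring.
have t_neq0 : t != 0.
  apply: contra_neq beta_neq0 => t0; move: e.
  by rewrite t0 raddf0 mul0r => /esym/eqP; rewrite fmorph_eq0 => /eqP.
case: (ltngtP I J) => // lt. 
  have {e} e : frob (J - I) t * (alpha * t + gamma) = frob (J - I) beta.
    by apply: (@frob_inj K F I); rewrite rmorphM /= !frob_comp subnKC // ltnW.
  have ft_neq0 : frob (J - I) t != 0 by rewrite fmorph_eq0.
  have /negP[] := noroot_lt (- (beta / t)) lt.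
  rewrite rmorphN fmorph_div /= -e; apply/eqP; field.
  by rewrite t_neq0 ft_neq0.
have {e} e : t * frob (I - J) (alpha * t + gamma) = beta.
  by apply: (@frob_inj K F J); rewrite rmorphM /= !frob_comp subnKC // ltnW.
have /negP[] := noroot_gt (- (alpha * t + gamma)) lt.
by rewrite rmorphN /= -e; apply/eqP; ring.
Qed.

End NoRoot.

(** * Rank weights of the codewords of H_0 *)

Section Weight.

Variables (K : finFieldType) (F : fieldExtType K).
Local Notation toF := (map_mx (in_alg F)).
Local Notation m := (\dim {:F}).
Local Notation frob := (@frob K F).
Local Notation tr := (@tr K F).

(** The entries of a word of weight at most m - 2 span a subspace of F whose
    orthogonal for the trace form has dimension at least 2. *)
Lemma trace_annihilator n (x : 'rV[F]_n) : (supp x < m - 1)%N ->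
  exists z w, [/\ z != 0, forall a : K, w <> a *: z,
    forall j, tr (z * x 0 j) = 0 & forall j, tr (w * x 0 j) = 0].
Proof.
have [y xE] := expand_factor x; rewrite supp_rowE => lt_xm.
pose r := \rank (expand_mx x).
pose g (z : F) : 'rV[K]_r := \row_l trK (z * y 0 l).
have g_lin : linear g.
  move=> a u v; apply/rowP => l; rewrite !mxE mulrDl -scalerAl.
  exact: trK_linear.
pose gL : {linear _ -> _} := HB.pack g (GRing.isLinear.Build _ _ _ _ g g_lin).
pose Z := lker (linfun gL).
have dimZ : (1 < \dim Z)%N.
  have le_im : (\dim (limg (linfun gL)) <= r)%N.
    by apply: leq_trans (dimvS (subvf _)) _; rewrite dimvf /dim /= mul1n.
  have := limg_ker_dim (linfun gL) fullv; rewrite capfv -/Z => rk.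
  rewrite ltnNge; apply/negP => le_Z1.
  have : (m <= 1 + r)%N by rewrite -[m]rk leq_add.
  by move: lt_xm; rewrite -/r; lia.
have ZP z : z \in Z -> forall j, tr (z * x 0 j) = 0.
  rewrite memv_ker lfunE => /eqP gz j.
  rewrite xE mulmx_inalgE mulr_sumr linear_sum big1 // => l _ /=.
  rewrite -scalerAr linearZ /= trKE.
  by move/rowP/(_ l): gz; rewrite /= !mxE => ->; rewrite scale0r scaler0.
have z_neq0 : vpick Z != 0 by rewrite vpick0 -dimv_eq0 -lt0n ltnW.
have /subvPn[w wZ wz] : ~~ (Z <= <[vpick Z]>)%VS.
  by apply: contraL dimZ => /dimvS; rewrite dim_vline z_neq0 -leqNgt.
exists (vpick Z), w; split => //.
- by move=> a wE; case/negP: wz; apply/vlineP; exists a.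
- exact/ZP/memv_pick.
- exact: ZP.
Qed.

Lemma trace_adjoint I J z a b c : (I <= m)%N -> (J <= m)%N ->
  (forall x, tr (z * (a * x + b * frob I x + c * frob J x)) = 0) ->
  a * z + frob (m - I) b * frob (m - I) z + frob (m - J) c * frob (m - J) z = 0.
Proof.
move=> le_I le_J z0; apply: (@tr_nondeg K F) => x; rewrite -[RHS](z0 x).
rewrite !mulrDl !mulrDr !linearD /= !tr_adjoint // !frobM.
by congr (tr _ + _ + _); ring.
Qed.

Variables (I J : nat) (alpha beta gamma : F).
Hypotheses (neq_IJ : I <> J) (ltIm : (I < m)%N) (ltJm : (J < m)%N).
Hypothesis gcd_IJm : gcdn (gcdn I J) m = 1%N.
Hypotheses (alpha_neq0 : alpha != 0) (beta_neq0 : beta != 0).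
Hypothesis P_noroot : forall x, ~~ root (P_poly #|K| I J alpha beta gamma) x.

(** Each annihilator t satisfies two adjoint equations, linear in t, its
    (m - I)-th and its (m - J)-th Frobenius image. Eliminating the linear terms
    between z and w leaves a homogeneous 2 x 2 system in the minors DI and DJ.
    They do not both vanish because z and w are independent over K, so the
    determinant of the system does, and noroot_adjoint applies to it. *)
Lemma no_independent_annihilators (z w u0 u1 u2 u3 : F) :
  z != 0 -> (forall a : K, w <> a *: z) ->
  (forall t : F, t \in [:: z; w] -> forall x,
    tr (t * (u0 * x + u2 * frob I x + u3 * frob J x)) = 0 /\
    tr (t * (u1 * x + (beta * u3) * frob I x
             + (alpha * u2 + gamma * u3) * frob J x)) = 0) ->
  [/\ u0 = 0, u1 = 0, u2 = 0 & u3 = 0].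
Proof.
move=> z_neq0 wz tr0; have [leI leJ] := (ltnW ltIm, ltnW ltJm).
have eq1 t : t \in [:: z; w] -> _ :=
  fun tP => trace_adjoint leI leJ (fun x => (tr0 t tP x).1).
have eq2 t : t \in [:: z; w] -> _ :=
  fun tP => trace_adjoint leI leJ (fun x => (tr0 t tP x).2).
have [zP wP] : z \in [:: z; w] /\ w \in [:: z; w] by rewrite !inE !eqxx orbT.
move: (eq1 z zP) (eq1 w wP) (eq2 z zP) (eq2 w wP) => {eq1 eq2}.
set zI := frob (m - I) z; set zJ := frob (m - J) z.
set wI := frob (m - I) w; set wJ := frob (m - J) w.
set B := frob _ u2; set C := frob _ u3; set B' := frob _ _; set C' := frob _ _.
move=> z1 w1 z2 w2.
have comb (s t l1 l2 x : F) : l1 = 0 -> l2 = 0 -> x = s * l1 + t * l2 -> x = 0.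
  by move=> -> -> ->; rewrite !mulr0 addr0.
pose DI := zI * w - wI * z; pose DJ := zJ * w - wJ * z.
have D1 : B * DI + C * DJ = 0.
  by apply: (comb w (- z) _ _ _ z1 w1); rewrite /DI /DJ; ring.
have D2 : B' * DI + C' * DJ = 0.
  by apply: (comb w (- z) _ _ _ z2 w2); rewrite /DI /DJ; ring.
have nD : ~ (DI = 0 /\ DJ = 0).
  case=> /eqP DI0 /eqP DJ0; move: DI0 DJ0; rewrite !subr_eq0 => /eqP DI0 /eqP DJ0.
  (* A vanishing minor says that w / z is fixed by a Frobenius map. *)
  have fixed i : (i <= m)%N -> frob (m - i) z * w = frob (m - i) w * z ->
      frob i (w / z) = w / z.
    move=> le_im e; apply: (@frob_inj K F (m - i)).
    rewrite frobK // fmorph_div /=; apply/eqP.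
    by rewrite eqr_div // ?fmorph_eq0 // -e mulrC.
  have [a wza] := frob_fixed_coprime gcd_IJm (fixed I leI DI0) (fixed J leJ DJ0).
  by apply: (wz a); rewrite -mulr_algl -[a%:A]wza divfK.
have det0 : B * C' - B' * C = 0.
  apply/eqP/negPn/negP => det_neq0; apply: nD; split; apply: (mulfI det_neq0);
    rewrite mulr0.
    by apply: (comb C' (- C) _ _ _ D1 D2); ring.
  by apply: (comb (- B') B _ _ _ D1 D2); ring.
have [u2_0 u3_0] : u2 = 0 /\ u3 = 0.
  apply: (noroot_adjoint neq_IJ alpha_neq0 beta_neq0 P_noroot).
  have fB x : frob (I + J) (frob (m - I) x) = frob J x.
    by rewrite addnC -frob_comp frobKV.
  have fC x : frob (I + J) (frob (m - J) x) = frob I x.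
    by rewrite -frob_comp frobKV.
  move/eqP: det0; rewrite subr_eq0 => /eqP /(congr1 (frob (I + J))).
  by rewrite !frobM fB !fC fB => ->; rewrite frobM mulrC.
have [Bz Cz] : B = 0 /\ C = 0 by rewrite /B /C u2_0 u3_0 !raddf0.
have [B'z C'z] : B' = 0 /\ C' = 0.
  by rewrite /B' /C' u2_0 u3_0 !mulr0 addr0 !raddf0.
split=> //; apply: (mulIf z_neq0); rewrite mul0r.
  by rewrite -[RHS]z1 Bz Cz !mul0r !addr0.
by rewrite -[RHS]z2 B'z C'z !mul0r !addr0.
Qed.

Lemma sum_ord4 (f : 'I_4 -> F) :
  \sum_i f i = f ord0 + f o1 + f o2 + f o3.
Proof.
rewrite !big_ord_recl big_ord0 addr0 -!addrA.
by congr (f _ + (f _ + (f _ + f _))); apply/val_inj.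
Qed.

Variable xi : m.-tuple F.
Hypothesis xi_basis : basis_of {:F} xi.
Local Notation H0 := (H0_mx #|K| I J alpha beta gamma xi).

Lemma mul_H0_l i (u : 'M[F]_(i, 4)) l j :
  (u *m H0) l (lshift m j) =
  let x := tnth xi j in u l ord0 * x + u l o2 * frob I x + u l o3 * frob J x.
Proof.
rewrite mxE sum_ord4 /H0_mx !row_mxEl !mxE /=.
by rewrite mulr0 addr0.
Qed.

Lemma mul_H0_r i (u : 'M[F]_(i, 4)) l j :
  (u *m H0) l (rshift m j) =
  let y := tnth xi j in u l o1 * y + (beta * u l o3) * frob I y
    + (alpha * u l o2 + gamma * u l o3) * frob J y.
Proof.
rewrite mxE sum_ord4 /H0_mx !row_mxEr !mxE /= /frob.
by ring.
Qed.

(** A codeword lists the values on a basis of the two linearized polynomials fx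
    and fy, so whatever annihilates its entries for the trace form annihilates
    the images of both. *)
Lemma supp_H0 (u : 'rV[F]_4) : u != 0 -> (m - 1 <= supp (u *m H0))%N.
Proof.
move=> u_neq0; rewrite leqNgt; apply/negP => /trace_annihilator.
case=> z [w [z_neq0 wz z0 w0]].
pose fx x := u 0 ord0 * x + u 0 o2 * frob I x + u 0 o3 * frob J x.
pose fy y := u 0 o1 * y + (beta * u 0 o3) * frob I y
    + (alpha * u 0 o2 + gamma * u 0 o3) * frob J y.
have ext (f : F -> F) t : linear f -> (forall j, tr (t * f (tnth xi j)) = 0) ->
    forall x, tr (t * f x) = 0.
  move=> f_lin f0 x.
  pose fL : {linear _ -> _} := HB.pack f (GRing.isLinear.Build _ _ _ _ f f_lin).
  rewrite (coord_basis xi_basis (memvf x)) -[f _]/(fL _).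
  rewrite linear_sum mulr_sumr linear_sum.
  apply: big1 => j _; rewrite linearZ /= -scalerAr linearZ /=.
  by rewrite -tnth_nth f0 scaler0.
have fx_lin : linear fx.
  move=> a x y; rewrite /fx !frobD !frobZ !mulrDr -!scalerAr !scalerDr.
  by rewrite [X in X + _ = _]addrACA [LHS]addrACA.
have fy_lin : linear fy.
  move=> a x y; rewrite /fy !frobD !frobZ !mulrDr -!scalerAr !scalerDr.
  by rewrite [X in X + _ = _]addrACA [LHS]addrACA.
have vanish t : (forall j, tr (t * (u *m H0) 0 j) = 0) ->
    forall x, tr (t * fx x) = 0 /\ tr (t * fy x) = 0.
  move=> t0 x; split; apply: ext => // j.
    by have := t0 (lshift m j); rewrite mul_H0_l.
  by have := t0 (rshift m j); rewrite mul_H0_r.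
have [|u0 u1 u2 u3] :=
  @no_independent_annihilators z w (u 0 ord0) (u 0 o1) (u 0 o2) (u 0 o3) z_neq0 wz.
  by move=> t; rewrite !inE => /orP[] /eqP -> x; apply: vanish.
case/eqP: u_neq0; apply/rowP => -[[|[|[|[|//]]]] lt]; rewrite mxE.
- by rewrite -[RHS]u0; congr (u _ _); apply/val_inj.
- by rewrite -[RHS]u1; congr (u _ _); apply/val_inj.
- by rewrite -[RHS]u2; congr (u _ _); apply/val_inj.
- by rewrite -[RHS]u3; congr (u _ _); apply/val_inj.
Qed.

End Weight.

(** * Kernels of linearized polynomials *)

Section Descent.

Variables (K : finFieldType) (F : fieldExtType K).
Local Notation toF := (map_mx (in_alg F)).
Local Notation m := (\dim {:F}).
Local Notation frob := (@frob K F).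

(** Galois descent for the left kernel of W. The first hypothesis makes this
    kernel stable under the inverse of the Frobenius map, hence under all its
    powers; a nonzero kernel vector c then yields, as the trace of a multiple of c,
    a nonzero kernel vector with entries in K. *)
Lemma frobenius_descent r N (W : 'M[F]_(r, N)) :
  (forall c : 'rV[F]_r, c *m W = 0 -> c *m map_mx (frob 1) W = 0) ->
  (forall a : 'rV[K]_r, toF a *m W = 0 -> a = 0) ->
  (r <= N)%N.
Proof.
move=> W_stable W_indep; rewrite leqNgt; apply/negP => lt_Nr.
have /rowV0Pn[c] : kermx W != 0.
  rewrite kermx_eq0 /row_free; apply: contraL lt_Nr => /eqP <-.
  by rewrite -leqNgt rank_leq_col.
move/sub_kermxP=> cW /eqP[]; apply/rowP => k; rewrite [RHS]mxE.
apply: (@tr_nondeg K F) => lambda; rewrite mulrC.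
(* Induction on j: each step applies the inverse of the Frobenius map. *)
have conj j : (j <= m)%N -> map_mx (frob (m - j)) (lambda *: c) *m W = 0.
  elim: j => [_|j IH lt_jm].
    rewrite subn0 (_ : map_mx _ _ = lambda *: c) -?scalemxAl ?cW ?scaler0 //.
    by apply/matrixP => i j; rewrite mxE frob_dim.
  have /W_stable := IH (ltnW lt_jm).
  move/(congr1 (map_mx (frob (m - 1)))); rewrite map_mxM map_mx0 -!map_mx_comp.
  rewrite [X in _ *m X](_ : _ = W); last first.
    by apply/matrixP => i l; rewrite mxE /= frobK // (dim_gt0 F).
  rewrite [X in X *m _](_ : _ = map_mx (frob (m - j.+1)) (lambda *: c)) //.
  apply/matrixP => i l; rewrite !mxE /= frob_comp.
  by rewrite -[in RHS](frob_dim (lambda * _)) frob_comp; congr (frob _ _); lia.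
have trW : toF (map_mx (@trK K F) (lambda *: c)) *m W = 0.
  rewrite (_ : toF _ = \sum_(j < m) map_mx (frob (m - (m - j))) (lambda *: c)).
    by rewrite mulmx_suml big1 // => j _; rewrite conj // leq_subr.
  apply/matrixP => i l; rewrite [LHS]mxE [X in in_alg F X]mxE -trKE summxE.
  by apply: eq_bigr => j _; rewrite !mxE subKn // ltnW.
by move/rowP/(_ k): (W_indep _ trW); rewrite !mxE trKE => ->; rewrite rmorph0.
Qed.

Definition Kindep r (t : 'I_r -> F) :=
  forall a : 'rV[K]_r, \sum_i a 0 i *: t i = 0 -> a = 0.

(** A linearized polynomial of q-degree d has at most d roots independent over
    K. Once f d is nonzero, the rows (t i, frob 1 (t i), .., frob (d - 1) (t i))
    satisfy the hypotheses of frobenius_descent, because frob d (t i) is a fixed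
    F-combination of them. *)
Lemma qpoly_kernel_dim r (t : 'I_r -> F) d (f : nat -> F) :
  Kindep t ->
  (forall i, \sum_(j < d.+1) f j * frob j (t i) = 0) ->
  (exists2 j, (j <= d)%N & f j != 0) -> (r <= d)%N.
Proof.
move=> t_indep; elim: d => [|d IH] ft [j le_jd fj].
  have t0 i : t i = 0.
    have := ft i; rewrite big_ord1 /frob expr1 => /eqP; rewrite mulf_eq0.
    by case/orP => /eqP // f0; case/eqP: fj; case: j le_jd.
  apply: (@frobenius_descent r 0 0) => [c _|a _]; first exact: thinmx0.
  by apply: t_indep; rewrite big1 // => i _; rewrite t0 scaler0.
have [fd0|fd_neq0] := eqVneq (f d.+1) 0.
  apply/leqW/IH => [i|]; last first.
    exists j => //; rewrite -ltnS ltn_neqAle le_jd andbT.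
    by apply: contraNneq fj => ->; rewrite fd0.
  by have := ft i; rewrite big_ord_recr /= fd0 mul0r addr0.
pose W := \matrix_(i < r, j < d.+1) frob j (t i).
have WE (c : 'rV[F]_r) k : (c *m W) 0 k = \sum_i c 0 i * frob k (t i).
  by rewrite mxE; apply: eq_bigr => i _; rewrite mxE.
apply: (@frobenius_descent r d.+1 W) => [c cW|a aW]; last first.
  apply: t_indep; move/rowP/(_ ord0): aW; rewrite WE mxE => {2}<-.
  by apply: eq_bigr => i _; rewrite mxE mulr_algl /frob expr1.
have cW0 (k : 'I_d.+1) : \sum_i c 0 i * frob k (t i) = 0.
  by rewrite -WE cW mxE.
apply/rowP => k; rewrite [RHS]mxE mxE.
under eq_bigr do rewrite 2!mxE frob_comp add1n.
have [lt_kd|le_dk] := ltnP k d; first exact: (cW0 (Ordinal (lt_kd : k.+1 < d.+1)%N)).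
have -> : (k : nat) = d by apply/eqP; rewrite eqn_leq le_dk -ltnS ltn_ord.
apply: (mulfI fd_neq0); rewrite mulr0.
have : \sum_(j < d.+2) f j * (\sum_i c 0 i * frob j (t i)) = 0.
  transitivity (\sum_i \sum_(j < d.+2) c 0 i * (f j * frob j (t i))); last first.
    by apply: big1 => i _; rewrite -mulr_sumr ft mulr0.
  rewrite exchange_big; apply: eq_bigr => l _; rewrite mulr_sumr.
  by apply: eq_bigr => i _; rewrite mulrCA.
by rewrite big_ord_recr /= big1 ?add0r // => l _; rewrite cW0 mulr0.
Qed.

End Descent.

(** * Supports of two-dimensional subcodes *)

Section SecondWeight.

Variables (K : finFieldType) (F : fieldExtType K).
Local Notation toF := (map_mx (in_alg F)).
Local Notation m := (\dim {:F}).
Local Notation frob := (@frob K F).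
Variables (I J : nat) (alpha beta gamma : F).
Hypotheses (neq_IJ : I <> J) (I_gt0 : (0 < I)%N) (J_gt0 : (0 < J)%N).
Hypotheses (alpha_neq0 : alpha != 0) (beta_neq0 : beta != 0).
Hypothesis P_noroot : forall x, ~~ root (P_poly #|K| I J alpha beta gamma) x.
Local Notation M := (maxn I J).

Lemma sum_delta d k (c : F) (g : nat -> F) : (k <= d)%N ->
  \sum_(j < d.+1) (c *+ (j == k :> nat)) * g j = c * g k.
Proof.
move=> le_kd; rewrite (bigD1 (Ordinal (le_kd : k < d.+1)%N)) //= eqxx mulr1n.
rewrite big1 ?addr0 // => j /negPf; rewrite -val_eqE /= => ->.
by rewrite mulr0n mul0r.
Qed.

Lemma trinomial_kernel_dim r (t : 'I_r -> F) c0 cI cJ :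
  Kindep t -> (forall i, c0 * t i + cI * frob I (t i) + cJ * frob J (t i) = 0) ->
  [|| c0 != 0, cI != 0 | cJ != 0] -> (r <= M)%N.
Proof.
move=> t_indep ct c_neq0.
pose f (j : nat) := c0 *+ (j == 0%N) + cI *+ (j == I) + cJ *+ (j == J).
apply: (qpoly_kernel_dim t_indep (f := f)) => [i|].
  rewrite -[RHS](ct i); under eq_bigr do rewrite /f !mulrDl.
  rewrite !big_split /=.
  rewrite -[X in c0 * X](_ : frob 0 (t i) = _); last by rewrite /frob expr1.
  by rewrite !(@sum_delta _ _ _ (fun j => frob j (t i))) ?leq_maxl ?leq_maxr.
have [eI eJ eIJ] : [/\ (I == 0%N) = false, (J == 0%N) = false & (I == J) = false].
  by split; [rewrite gtn_eqF | rewrite gtn_eqF | apply/eqP].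
case/or3P: c_neq0 => c_neq0.
- by exists 0%N; rewrite // /f eqxx ![0%N == _]eq_sym eI eJ !mulr0n !addr0.
- by exists I; rewrite ?leq_maxl // /f eqxx eI eIJ !mulr0n addr0 add0r.
- by exists J; rewrite ?leq_maxr // /f eqxx eJ [J == I]eq_sym eIJ !mulr0n !add0r.
Qed.

Section TwoEquations.

Variables (r : nat) (x y : 'I_r -> F) (u : 'M[F]_(2, 4)).
Hypothesis u_free : row_free u.
Hypothesis xy_indep : forall a : 'rV[K]_r,
  \sum_i a 0 i *: x i = 0 -> \sum_i a 0 i *: y i = 0 -> a = 0.
Hypothesis xy_eq : forall l i,
  u l ord0 * x i + u l o1 * y i
  + u l o2 * (frob I (x i) + alpha * frob J (y i))
  + u l o3 * (frob J (x i) + beta * frob I (y i) + gamma * frob J (y i)) = 0.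

Let delta := u ord0 o2 * u ord_max o3 - u ord0 o3 * u ord_max o2.

(** When the coefficients of the twisted terms form an invertible matrix, the two
    equations express the M-th Frobenius images of x and y through the lower ones,
    and frobenius_descent applies to the 2 * M columns of these lower images. *)
Lemma regular_pair_bound : delta != 0 -> (r <= 2 * M)%N.
Proof.
move=> d_neq0; rewrite mul2n -addnn.
have M_gt0 : (0 < M)%N by apply: leq_trans I_gt0 (leq_maxl _ _).
pose W := row_mx (\matrix_(i < r, j < M) frob j (x i))
                 (\matrix_(i < r, j < M) frob j (y i)).
have WE (z : 'I_r -> F) (c : 'rV[F]_r) (j : 'I_M) :
    (c *m \matrix_(i < r, j < M) frob j (z i)) 0 j = \sum_i c 0 i * frob j (z i).
  by rewrite mxE; apply: eq_bigr => i _; rewrite mxE.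
have W0 (c : 'rV[F]_r) : c *m W = 0 -> forall j, (j < M)%N ->
    \sum_i c 0 i * frob j (x i) = 0 /\ \sum_i c 0 i * frob j (y i) = 0.
  rewrite mul_mx_row -row_mx0 => /eq_row_mx[cx cy] j lt_j.
  by rewrite -!(WE _ _ (Ordinal lt_j)) cx cy mxE.
apply: (@frobenius_descent K F r (M + M) W) => [c cW|a aW]; last first.
  have [ax ay] := W0 _ aW 0%N M_gt0.
  by apply: xy_indep; [rewrite -[RHS]ax | rewrite -[RHS]ay];
     apply: eq_bigr => i _; rewrite mxE mulr_algl /frob expr1.
have cW0 := W0 _ cW.
pose X j := \sum_i c 0 i * frob j (x i); pose Y j := \sum_i c 0 i * frob j (y i).
have [X0 Y0] : X 0%N = 0 /\ Y 0%N = 0 := cW0 _ M_gt0.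
have E l : u l o2 * (X I + alpha * Y J)
    + u l o3 * (X J + beta * Y I + gamma * Y J) = 0.
  transitivity (\sum_i c 0 i * (u l ord0 * x i + u l o1 * y i
      + u l o2 * (frob I (x i) + alpha * frob J (y i))
      + u l o3 * (frob J (x i) + beta * frob I (y i) + gamma * frob J (y i)))).
    rewrite -[LHS]add0r -[in LHS](mulr0 (u l ord0)) -[in X in X + _]X0.
    rewrite -[LHS]add0r -[in LHS](mulr0 (u l o1)) -[in X in X + _]Y0.
    rewrite /X /Y !mulr_sumr -!big_split !mulr_sumr -!big_split /=.
    by apply: eq_bigr => i _; rewrite [frob 0 (x i)]expr1 [frob 0 (y i)]expr1; ring.
  by rewrite big1 // => i _; rewrite xy_eq mulr0.
have [A0 B0] : X I + alpha * Y J = 0 /\ X J + beta * Y I + gamma * Y J = 0.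
  have comb (s t l1 l2 z : F) :
      l1 = 0 -> l2 = 0 -> delta * z = s * l1 + t * l2 -> z = 0.
    by move=> -> -> e; apply: (mulfI d_neq0); rewrite e !mulr0 addr0.
  split.
    apply: (comb (u ord_max o3) (- u ord0 o3) _ _ _ (E ord0) (E ord_max)).
    by rewrite /delta; ring.
  apply: (comb (- u ord_max o2) (u ord0 o2) _ _ _ (E ord0) (E ord_max)).
  by rewrite /delta; ring.
(* One equation contains a single M-th Frobenius image; it determines that image,
   and then the other equation determines the second one. *)
have [XM YM] : X M = 0 /\ Y M = 0.
  case: (ltngtP I J) => // lt.
    have eM : M = J by apply/maxn_idPr/ltnW.
    have [XI YI] := cW0 I (leq_trans lt (leq_maxr _ _)).
    have YJ : Y J = 0.
      by apply: (mulfI alpha_neq0); move: A0; rewrite [X I]XI add0r mulr0.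
    by rewrite ?eM; split => //; move: B0; rewrite YJ [Y I]YI !mulr0 !addr0.
  have eM : M = I by apply/maxn_idPl/ltnW.
  have [XJ YJ] := cW0 J (leq_trans lt (leq_maxl _ _)).
  rewrite ?eM; split; first by move: A0; rewrite [Y J]YJ mulr0 addr0.
  apply: (mulfI beta_neq0); move: B0.
  by rewrite [X J]XJ [Y J]YJ !mulr0 addr0 add0r.
have step (z : 'I_r -> F) : (forall j, (j < M)%N -> \sum_i c 0 i * frob j (z i) = 0) ->
    \sum_i c 0 i * frob M (z i) = 0 ->
    c *m map_mx (frob 1) (\matrix_(i < r, j < M) frob j (z i)) = 0.
  move=> z0 zM; apply/rowP => j; rewrite [RHS]mxE mxE.
  under eq_bigr do rewrite 2!mxE frob_comp add1n.
  have [/z0 //|le_Mj] := ltnP j.+1 M.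
  by have -> : j.+1 = M by apply/eqP; rewrite eqn_leq le_Mj andbT.
rewrite map_row_mx mul_mx_row !step ?row_mx0 //.
  by move=> j /cW0[].
by move=> j /cW0[].
Qed.

(** Otherwise some combination of the two equations is a nontrivial F-linear
    relation between x and y. It puts all the solutions on a line, parametrized by
    t, where the equations become trinomials in t; noroot_line and the independence
    of the two equations prevent them from vanishing identically. *)
Lemma singular_pair_bound : delta = 0 -> (r <= M)%N.
Proof.
move=> d0.
(* A left kernel vector of the singular matrix of twisted coefficients. *)
have [l0 [l1 [l_neq0 l2 l3]]] : exists l0 l1, [/\ (l0 != 0) || (l1 != 0),
    l0 * u ord0 o2 + l1 * u ord_max o2 = 0 & l0 * u ord0 o3 + l1 * u ord_max o3 = 0].
  have [u2_0|u2_neq0] := eqVneq (u ord0 o2) 0; last first.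
    exists (u ord_max o2), (- u ord0 o2); split; [| by ring |].
      by rewrite oppr_eq0 u2_neq0 orbT.
    by rewrite -[RHS]oppr0 -[in RHS]d0 /delta; ring.
  have [u3_0|u3_neq0] := eqVneq (u ord0 o3) 0; last first.
    exists (u ord_max o3), (- u ord0 o3); split; [| | by ring].
      by rewrite oppr_eq0 u3_neq0 orbT.
    by rewrite -[in RHS]d0 /delta; ring.
  by exists 1, 0; rewrite u2_0 u3_0 oner_neq0 !mulr0 !mul0r addr0.
pose p0 := l0 * u ord0 ord0 + l1 * u ord_max ord0.
pose p1 := l0 * u ord0 o1 + l1 * u ord_max o1.
have sum2 (f : 'I_2 -> F) : \sum_i f i = f ord0 + f ord_max.
  by rewrite big_ord_recl big_ord1; congr (_ + f _); apply/val_inj.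
have p_neq0 : (p0 != 0) || (p1 != 0).
  rewrite -negb_and; apply/negP => /andP[/eqP p0_0 /eqP p1_0].
  pose l := \row_(i < 2) (if i == ord0 then l0 else l1).
  have : l *m u == 0.
    apply/eqP/rowP => k; rewrite !mxE sum2 !mxE /=.
    case: k => [[|[|[|[|//]]]] lt];
    [rewrite -[RHS]p0_0 | rewrite -[RHS]p1_0 | rewrite -[RHS]l2 | rewrite -[RHS]l3];
    by congr (_ * u _ _ + _ * u _ _); apply/val_inj.
  rewrite mulmx_free_eq0 // => /eqP/rowP l0'.
  have := l0' ord0; have := l0' ord_max; rewrite !mxE /= => l1_0 l0_0.
  by move: l_neq0; rewrite l1_0 l0_0 eqxx.
have pxy i : p0 * x i + p1 * y i = 0.
  pose g := frob I (x i) + alpha * frob J (y i).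
  pose h := frob J (x i) + beta * frob I (y i) + gamma * frob J (y i).
  pose e l := u l ord0 * x i + u l o1 * y i + u l o2 * g + u l o3 * h.
  have -> : p0 * x i + p1 * y i = l0 * e ord0 + l1 * e ord_max
      - (l0 * u ord0 o2 + l1 * u ord_max o2) * g
      - (l0 * u ord0 o3 + l1 * u ord_max o3) * h by rewrite /p0 /p1 /e; ring.
  by rewrite /e /g /h !xy_eq l2 l3 !mulr0 !mul0r !subr0 addr0.
have [t tE] : exists t : 'I_r -> F, forall i, x i = p1 * t i /\ y i = - p0 * t i.
  case: (eqVneq p1 0) p_neq0 => [p1_0|p1_neq0 _].
    rewrite orbF => p0_neq0; exists (fun i => - (y i / p0)) => i.
    have := pxy i; rewrite p1_0 !mul0r addr0 => /eqP.
    rewrite mulf_eq0 (negPf p0_neq0) => /eqP ->; split=> //.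
    by rewrite mulrNN mulrC divfK.
  exists (fun i => x i / p1) => i; rewrite mulrC divfK //; split=> //.
  apply: (mulfI p1_neq0); transitivity (- (p0 * x i)).
    by apply/eqP; rewrite -addr_eq0 addrC pxy.
  by field.
have t_indep : Kindep t.
  have scaled (a : 'rV[K]_r) p :
      \sum_i a 0 i *: t i = 0 -> \sum_i a 0 i *: (p * t i) = 0.
    move=> at0; transitivity (p * (\sum_i a 0 i *: t i)); last by rewrite at0 mulr0.
    rewrite mulr_sumr.
    by apply: eq_bigr => i _; rewrite scalerAr.
  move=> a /scaled at0; apply: xy_indep.
    by rewrite -[RHS](at0 p1); apply: eq_bigr => i _; rewrite (tE i).1.
  by rewrite -[RHS](at0 (- p0)); apply: eq_bigr => i _; rewrite (tE i).2.
pose c0 l := u l ord0 * p1 - u l o1 * p0.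
pose cI l := u l o2 * frob I p1 - u l o3 * beta * frob I p0.
pose cJ l := u l o3 * (frob J p1 - gamma * frob J p0) - u l o2 * alpha * frob J p0.
have ct l i : c0 l * t i + cI l * frob I (t i) + cJ l * frob J (t i) = 0.
  rewrite -[RHS](xy_eq l i) (tE i).1 (tE i).2 !frobM !frobN /c0 /cI /cJ.
  by ring.
suff [l cl] : exists l, [|| c0 l != 0, cI l != 0 | cJ l != 0].
  exact: (trinomial_kernel_dim t_indep (ct l) cl).
apply/existsP; apply: contraT => /existsPn c_0.
have {}c_0 l : [/\ c0 l = 0, u l o2 = 0 & u l o3 = 0].
  have := c_0 l; rewrite !negb_or !negbK => /and3P[/eqP -> /eqP cI0 /eqP cJ0].
  pose a := u l o2; pose b := u l o3.
  have comb (s v e1 e2 z : F) : e1 = 0 -> e2 = 0 -> z = s * e1 + v * e2 -> z = 0.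
    by move=> -> -> ->; rewrite !mulr0 addr0.
  pose d := frob I p1 * (frob J p1 - gamma * frob J p0)
    - alpha * beta * frob I p0 * frob J p0.
  have a0 : d * a = 0.
    by apply: (comb (frob J p1 - gamma * frob J p0) (beta * frob I p0) _ _ _ cI0 cJ0);
      rewrite /d /a /cI /cJ; ring.
  have b0 : d * b = 0.
    by apply: (comb (alpha * frob J p0) (frob I p1) _ _ _ cI0 cJ0);
      rewrite /d /b /cI /cJ; ring.
  suff d_neq0 : d != 0 by split => //; apply: (mulfI d_neq0); rewrite mulr0.
  apply: contraTneq p_neq0 => d_0.
  have [-> p0_0] : p1 = 0 /\ - p0 = 0.
    apply: (noroot_line neq_IJ P_noroot); apply/eqP; rewrite -subr_eq0 -d_0.
    by rewrite !frobN /d; apply/eqP; ring.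
  by rewrite -[p0]opprK p0_0 oppr0 eqxx.
(* If all trinomials vanished, both rows of u would be multiples of (p0 p1 0 0). *)
pose w := \row_(k < 4) (if k == ord0 then p0 else if k == o1 then p1 else 0).
have /mxrankS : (u <= w)%MS.
  apply/row_subP => l; have [cl u2 u3] := c_0 l.
  have {}cl : u l ord0 * p1 = u l o1 * p0 by apply/eqP; rewrite -subr_eq0 -/(c0 l) cl.
  have wE c : u l ord0 = c * p0 -> u l o1 = c * p1 -> (row l u <= w)%MS.
    move=> e0 e1; apply/sub_rVP; exists c; apply/rowP => k; rewrite !mxE.
    case: k => [[|[|[|[|//]]]] lt] /=;
    [rewrite -e0|rewrite -e1|rewrite mulr0 -[RHS]u2|rewrite mulr0 -[RHS]u3];
    by congr (u _ _); apply/val_inj.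
  case: (eqVneq p0 0) p_neq0 => [p0_0 p1_neq0|p0_neq0 _].
    apply: (wE (u l o1 / p1)); last by rewrite divfK.
    by rewrite mulrAC -cl mulfK.
  apply: (wE (u l ord0 / p0)); first by rewrite divfK.
  by rewrite mulrAC cl mulfK.
have /eqP -> := u_free.
by move/leq_trans => /(_ _ (rank_leq_row w)).
Qed.

Lemma pair_bound : (r <= 2 * M)%N.
Proof.
have [d0|] := eqVneq delta 0; last exact: regular_pair_bound.
by apply: leq_trans (singular_pair_bound d0) _; rewrite leq_pmull.
Qed.

End TwoEquations.

Variable xi : m.-tuple F.
Hypothesis xi_basis : basis_of {:F} xi.
Local Notation H0 := (H0_mx #|K| I J alpha beta gamma xi).

Lemma kernel_H0_bound r (u : 'M[F]_(2, 4)) (N : 'M[K]_(r, m + m)) :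
  row_free u -> row_free N -> u *m H0 *m toF N^T = 0 -> (r <= 2 * M)%N.
Proof.
move=> u_free N_free uN.
pose x i := \sum_j N i (lshift m j) *: tnth xi j.
pose y i := \sum_j N i (rshift m j) *: tnth xi j.
have xi_free (a : 'I_m -> K) : \sum_j a j *: tnth xi j = 0 -> forall j, a j = 0.
  move=> a0; apply: (freeP (basis_free xi_basis)); rewrite -[RHS]a0.
  by apply: eq_bigr => j _; rewrite (tnth_nth 0).
have aN (a : 'rV[K]_r) h :
    \sum_i a 0 i *: (\sum_j N i (h j) *: tnth xi j)
    = \sum_j (a *m N) 0 (h j) *: tnth xi j.
  under eq_bigr do rewrite scaler_sumr; rewrite exchange_big.
  apply: eq_bigr => j _; rewrite mxE scaler_suml.
  by apply: eq_bigr => i _; rewrite scalerA.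
apply: (@pair_bound r x y u u_free) => [a ax ay|l i].
  apply/eqP; rewrite -(mulmx_free_eq0 a N_free); apply/eqP/rowP => j.
  rewrite [RHS]mxE; have [k ->|k ->] := split_ordP j.
    by apply: (xi_free (fun j => (a *m N) 0 (lshift m j))); rewrite -aN.
  by apply: (xi_free (fun j => (a *m N) 0 (rshift m j))); rewrite -aN.
have /matrixP/(_ l i) := uN; rewrite [RHS]mxE => <-.
rewrite mxE big_split_ord /=.
have lin3 (c : 'I_m -> K) a0 aI aJ : let z := \sum_j c j *: tnth xi j in
    \sum_j c j *: (a0 * tnth xi j + aI * frob I (tnth xi j) + aJ * frob J (tnth xi j))
    = a0 * z + aI * frob I z + aJ * frob J z.
  rewrite /= !raddf_sum !mulr_sumr -!big_split; apply: eq_bigr => j _ /=.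
  by rewrite !frobZ !scalerDr !scalerAr.
have toFE k : toF N^T k i = in_alg F (N i k) by rewrite 2!mxE.
transitivity (\sum_j N i (lshift m j) *: (u *m H0) l (lshift m j)
   + \sum_j N i (rshift m j) *: (u *m H0) l (rshift m j)); last first.
  by congr (_ + _); apply: eq_bigr => j _; rewrite toFE mulrC mulr_algl.
under eq_bigr do rewrite mul_H0_l; under [X in _ = _ + X]eq_bigr do rewrite mul_H0_r.
by rewrite !lin3 -/(x i) -/(y i); ring.
Qed.

(** The s columns of the block Z contribute at most s to the kernel: the
    relations without coefficient on Z form a subspace of codimension at most s,
    to which kernel_H0_bound applies. *)
Lemma kernel_HB_bound s (b : s.-tuple F) r (u : 'M[F]_(2, 4))
    (N : 'M[K]_(r, m + m + s)) :
  row_free u -> row_free N ->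
  u *m HB_mx #|K| I J alpha beta gamma xi b *m toF N^T = 0 -> (r <= 2 * M + s)%N.
Proof.
move=> u_free N_free uN; pose Q := row_base (kermx (rsubmx N)).
have QN : Q *m N = row_mx (Q *m lsubmx N) 0.
  transitivity (Q *m row_mx (lsubmx N) (rsubmx N)); first by rewrite hsubmxK.
  rewrite mul_mx_row; congr row_mx.
  by apply/sub_kermxP; rewrite eq_row_base.
have QN_free : row_free (Q *m lsubmx N).
  rewrite /row_free -(rank_row_mx0 s) -QN mxrankMfree //.
  exact: row_base_free.
have : (\rank (kermx (rsubmx N)) <= 2 * M)%N.
  apply: (kernel_H0_bound u_free QN_free).
  transitivity (u *m HB_mx #|K| I J alpha beta gamma xi b *m toF (Q *m N)^T).
    rewrite /HB_mx QN tr_row_mx trmx0 map_col_mx map_mx0.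
    by rewrite -[RHS]mulmxA mul_row_col mulmx0 addr0 mulmxA.
  by rewrite trmx_mul map_mxM mulmxA uN mul0mx.
rewrite mxrank_ker; have := rank_leq_col (rsubmx N); lia.
Qed.

Lemma supp_HB2 s (b : s.-tuple F) (u : 'M[F]_(2, 4)) : row_free u ->
  (2 * (m - M) <= supp (u *m HB_mx #|K| I J alpha beta gamma xi b))%N.
Proof.
move=> u_free.
have [N [N_free uN]] := supp_ker (u *m HB_mx #|K| I J alpha beta gamma xi b).
by have := kernel_HB_bound u_free N_free uN; lia.
Qed.

End SecondWeight.

(** * Codes, systems and their equivalences *)

Section CodesAndSystems.

Variables (K : finFieldType) (F : fieldExtType K).
Local Notation toF := (map_mx (in_alg F)).
Local Notation m := (\dim {:F}).

Lemma min_dist_eq r n (C : 'M[F]_(r, n)) d :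
  (forall x : 'rV[F]_n, (x <= C)%MS -> x != 0 -> (d <= supp x)%N) ->
  (exists x : 'rV[F]_n, [/\ (x <= C)%MS, x != 0 & (supp x <= d)%N]) ->
  min_dist C = d.
Proof.
move=> lb [x [xC x_neq0 le_xd]].
have [] := @min_natP (fun d => exists x : 'rV[F]_n,
  [/\ (x <= C)%MS, x != 0 & rank_weight x = d]) (supp x).
  by exists x; rewrite rank_weightE.
case=> y [yC y_neq0]; rewrite rank_weightE -/(min_dist C) => <- le_yx.
by apply/eqP; rewrite eqn_leq lb // (leq_trans le_yx).
Qed.

Definition qtuple k n (G : 'M[F]_(k, n)) : n.-tuple {ffun 'I_k -> F} :=
  [tuple [ffun i => G i j] | j < n].

Lemma qcolsE k n (G : 'M[F]_(k, n)) : qcols G = qtuple G.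
Proof. by []. Qed.

Lemma qtuple_sum k n (G : 'M[F]_(k, n)) (a : 'I_n -> K) :
  vcol (\sum_j a j *: (qtuple G)`_j) = G *m toF (\row_j a j)^T.
Proof.
apply/colP => i; rewrite !mxE sum_ffunE; apply: eq_bigr => j _.
by rewrite -tnth_nth tnth_mktuple !ffunE !mxE mulrC mulr_algl.
Qed.

Lemma vcol_inj k : injective (@vcol K F k).
Proof. by move=> u v /colP uv; apply/ffunP => i; have := uv i; rewrite !mxE. Qed.

Lemma vcol0 k : vcol (0 : {ffun 'I_k -> F}) = 0.
Proof. by apply/colP => i; rewrite !mxE ffunE. Qed.

Lemma row_eta n (v : 'rV[K]_n) : \row_j v 0 j = v.
Proof. by apply/rowP => j; rewrite mxE. Qed.

Lemma free_qcolsP k n (G : 'M[F]_(k, n)) :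
  free (qcols G) <-> (forall v : 'rV[K]_n, G *m toF v^T = 0 -> v = 0).
Proof.
rewrite qcolsE; split => [/freeP G_free v Gv|G_indep].
  apply/rowP => j; rewrite mxE; apply: G_free; apply: vcol_inj.
  by rewrite qtuple_sum row_eta Gv vcol0.
apply/freeP => a a0 j; suff /rowP/(_ j) : \row_j a j = 0 by rewrite !mxE.
by apply: G_indep; rewrite -qtuple_sum a0 vcol0.
Qed.

Lemma mem_qspan k n (G : 'M[F]_(k, n)) (u : {ffun 'I_k -> F}) :
  u \in qspan G <-> exists v : 'rV[K]_n, vcol u = G *m toF v^T.
Proof.
rewrite /qspan qcolsE; split => [/coord_span uE|[v uE]].
  by exists (\row_j coord (qtuple G) j u); rewrite -qtuple_sum -uE.
rewrite (_ : u = \sum_j v 0 j *: (qtuple G)`_j).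
  by apply: memv_suml => j _; apply/memvZ/memv_span/mem_nth; rewrite size_tuple.
by apply: vcol_inj; rewrite qtuple_sum row_eta.
Qed.

Lemma col_qspan k n (G : 'M[F]_(k, n)) j : [ffun i => G i j] \in qspan G.
Proof. by apply/memv_span/mapP; exists j; rewrite ?mem_enum. Qed.

Lemma vcol_ffun k n (G : 'M[F]_(k, n)) j : vcol [ffun i => G i j] = col j G.
Proof. by apply/colP => i; rewrite !mxE ffunE. Qed.

Lemma factor_columns k n n' (G : 'M[F]_(k, n)) (G' : 'M[F]_(k, n')) :
  (forall j, exists v : 'rV[K]_n, col j G' = G *m toF v^T) ->
  exists A : 'M[K]_(n, n'), G' = G *m toF A.
Proof.
case/fin_all_exists => v vE; exists (\matrix_(i, j) v j 0 i).
apply/matrixP => i j; have /colP/(_ i) := vE j; rewrite mxE => ->.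
by rewrite !mxE; apply: eq_bigr => l _; rewrite !mxE.
Qed.

(** This is how the weights of two codes associated with the same system are
    compared. *)
Lemma qspan_factor k n (G G' : 'M[F]_(k, n)) :
  qspan G' = qspan G -> exists A : 'M[K]_n, G' = G *m toF A.
Proof.
move=> eGG'; apply: factor_columns => j.
have [+ _] := mem_qspan G [ffun i => G' i j]; rewrite vcol_ffun; apply.
by rewrite -eGG' col_qspan.
Qed.

Lemma associated_nondeg k r n (G : 'M[F]_(k, n)) (C : 'M[F]_(r, n)) :
  gen_matrix G C -> free (qcols G) -> nondeg_code C.
Proof.
move=> [G_free GC] G_indep; have rkC : \rank C = k.
  by rewrite -(eqmx_rank GC); apply/eqP.
by rewrite /nondeg_code rkC; exists G.
Qed.

(** With complementary ranks, the inclusion of the row space of H in the dual of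
    that of G is an equality. *)
Lemma annihilatorP k r n (G : 'M[F]_(k, n)) (H : 'M[F]_(r, n)) :
  G *m H^T = 0 -> (\rank G + \rank H)%N = n ->
  forall x : 'rV[F]_n, (x <= H)%MS = (G *m x^T == 0).
Proof.
move=> GH rk x.
have H_ker : (H <= kermx G^T)%MS.
  by apply/sub_kermxP/trmx_inj; rewrite trmx_mul trmxK trmx0.
have ker_H : (kermx G^T <= H)%MS.
  rewrite -(geq_leqif (mxrank_leqif_sup H_ker)) mxrank_ker mxrank_tr.
  by rewrite -[X in (X - _)%N]rk addKn.
rewrite -trmx_eq0 trmx_mul trmxK -sub_kermx.
by apply/idP/idP => /submx_trans; apply.
Qed.

(** Stated in the direction that lets lower bounds on supports pass from H to C.
    The support does not grow because undoing the isometry amounts to a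
    multiplication by a matrix over K and a field automorphism. *)
Lemma code_equiv_transport r r' n (H : 'M[F]_(r, n)) (C : 'M[F]_(r', n)) :
  code_equiv H C ->
  \rank C = \rank H /\
  forall i (V : 'M[F]_(i, n)), (V <= C)%MS -> row_free V ->
    exists V' : 'M[F]_(i, n), [/\ (V' <= H)%MS, row_free V' & (supp V' <= supp V)%N].
Proof.
case=> A [sigma [A_unit sigma_bij HC]].
have AF_unit : toF A \in unitmx by rewrite map_unitmx.
have [tau sK tK] := sigma_bij.
have tauK a b (w : 'M[F]_(a, b)) : map_mx sigma (map_mx tau w) = w.
  by apply/matrixP => i j; rewrite !mxE tK.
have eqC : (C == map_mx sigma H *m toF A)%MS.
  apply/andP; split; apply/rV_subP => x.
    move/HC => [c /submxP[w ->] ->].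
    by rewrite map_mxM -mulmxA submxMl.
  move=> /submxP[w ->]; apply/HC; exists (map_mx tau w *m H); first exact: submxMl.
  by rewrite map_mxM tauK mulmxA.
split=> [|i V VC V_free].
  by rewrite (eqmx_rank eqC) mxrankMfree ?mxrank_map // row_free_unit.
have /submxP[w Vw] : (V <= map_mx sigma H *m toF A)%MS.
  by case/andP: eqC => /(submx_trans VC).
pose V' := map_mx tau w *m H.
have VE : V = map_mx sigma V' *m toF A by rewrite Vw map_mxM tauK mulmxA.
exists V'; split; first exact: submxMl.
  by move: V_free; rewrite VE /row_free mxrankMfree ?row_free_unit // mxrank_map.
apply: leq_trans (supp_rmorph sigma_bij V') _.
have {1}-> : map_mx sigma V' = V *m toF (invmx A).
  by rewrite VE map_invmx mulmxK.
exact: supp_mulK.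
Qed.

Lemma direct_sum_blocks r n r1 n1 r2 n2 (C : 'M[F]_(r, n))
    (D1 : 'M[F]_(r1, n1)) (D2 : 'M[F]_(r2, n2)) :
  is_direct_sum C D1 D2 ->
  [/\ (n1 + n2 = n)%N, \rank C = (\rank D1 + \rank D2)%N &
    exists (E1 : 'M[K]_(n1, n)) (E2 : 'M[K]_(n2, n)),
    [/\ row_free E1, row_free E2, (D1 *m toF E1 <= C)%MS & (D2 *m toF E2 <= C)%MS]].
Proof.
case=> f f_bij eqC; have [g fK gK] := f_bij.
have en : (n1 + n2 = n)%N.
  by have := bij_eq_card f_bij; rewrite !card_ord => ->.
pose E : 'M[K]_(n1 + n2, n) := mxsub id f 1%:M.
have EE : E *m mxsub id g 1%:M = 1%:M.
  rewrite mulmx_colsub mulmx1 /E -mxsub_comp.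
  by apply: mxsub_eq_id => // i; rewrite /= gK.
have E_free : row_free E by apply/row_freeP; eexists; apply: EE.
have CE : mxsub id f (block_mx D1 0 0 D2) = block_mx D1 0 0 D2 *m toF E.
  by rewrite /E map_mxsub map_mx1 mulmx_colsub mulmx1.
have CE' : mxsub id f (block_mx D1 0 0 D2)
    = col_mx (D1 *m toF (usubmx E)) (D2 *m toF (dsubmx E)).
  rewrite CE -{1}(vsubmxK E) map_col_mx block_mxEv mul_col_mx !mul_row_col.
  by rewrite !mul0mx addr0 add0r.
split=> //.
  by rewrite (eqmx_rank eqC) CE mxrankMfree ?rank_diag_block_mx // /row_free mxrank_map.
exists (usubmx E), (dsubmx E).
have /andP[_ subC] := eqC; move: subC; rewrite CE' col_mx_sub => /andP[-> ->].
move: E_free; rewrite -{1}(vsubmxK E) => /row_freeP[X].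
rewrite mul_col_mx -[1%:M]vsubmxK => /eq_col_mx[uX dX].
rewrite (scalar_mx_block n1 n2 1) /block_mx col_mxKu in uX.
rewrite (scalar_mx_block n1 n2 1) /block_mx col_mxKd in dX.
split=> //; apply/row_freeP.
  by exists (X *m col_mx 1%:M 0); rewrite mulmxA uX mul_row_col mul0mx mul1mx addr0.
by exists (X *m col_mx 0 1%:M); rewrite mulmxA dX mul_row_col mul0mx mul1mx add0r.
Qed.

End CodesAndSystems.

(** * Direct sums *)

Section DirectSums.

Variables (K : finFieldType) (F : fieldExtType K).
Local Notation toF := (map_mx (in_alg F)).
Local Notation m := (\dim {:F}).

(** The two blocks have dimensions 2 + 2 or 1 + 3. In the first case each block
    is a plane whose support has at most n1, respectively n2, dimensions, and the
    smaller of these is at most m + s / 2 < d. In the second case the Singleton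
    bound for the three-dimensional block, which has minimum distance at least
    m - 1, forces its length to be at least 3 * m / 2; the other block is then too
    short to carry a word of weight m - 1. *)
Lemma no_direct_sum r r' n s d (H : 'M[F]_(r, n)) (C : 'M[F]_(r', n)) :
  n = (2 * m + s)%N -> (2 * s < m - 2)%N -> \rank H = 4 ->
  (forall x : 'rV[F]_n, (x <= H)%MS -> x != 0 -> (m - 1 <= supp x)%N) ->
  (forall V : 'M[F]_(2, n), (V <= H)%MS -> row_free V -> (d <= supp V)%N) ->
  (m + s %/ 2 < d)%N ->
  nontrivial_direct_sum C -> ~ code_equiv H C.
Proof.
move=> en lt_s rkH wt1 wt2 lt_d [n1 [n2 [D1 [D2 [_ D1_gt0 D2_gt0 sumC]]]]] equivHC.
have [rkC transport] := code_equiv_transport equivHC.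
have [en12 rkC12 [E1 [E2 [E1_free E2_free D1C D2C]]]] := direct_sum_blocks sumC.
have C1 (x : 'rV[F]_n) : (x <= C)%MS -> x != 0 -> (m - 1 <= supp x)%N.
  move=> xC x_neq0; have [|y [yH y_free]] := transport _ x xC.
    by rewrite /row_free rank_rV x_neq0.
  apply/leq_trans/wt1 => //; apply: contraTneq y_free => ->.
  by rewrite /row_free mxrank0.
have C2 (V : 'M[F]_(2, n)) : (V <= C)%MS -> row_free V -> (d <= supp V)%N.
  move=> VC V_free; have [W [WH W_free]] := transport _ V VC V_free.
  exact/leq_trans/wt2.
have side n' (D : 'M[F]_n') (E : 'M[K]_(n', n)) : row_free E -> (D *m toF E <= C)%MS ->
    [/\ (0 < \rank D -> m - 1 <= n')%N, (\rank D = 2 -> d <= n')%N &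
        (\rank D = 3 -> m * 3 <= 2 * n')%N].
  move=> E_free DC; have EF_free : row_free (toF E) by rewrite /row_free mxrank_map.
  have subC i (V : 'M[F]_(i, n')) : (V <= D)%MS -> (V *m toF E <= C)%MS.
    by move=> VD; apply: submx_trans DC; apply: submxMr.
  have suppE i (V : 'M[F]_(i, n')) : (supp (V *m toF E) <= n')%N.
    exact: leq_trans (supp_mulK _ _) (supp_leq _).
  have word (x : 'rV[F]_n') : (x <= D)%MS -> x != 0 -> (m - 1 <= supp (x *m toF E))%N.
    by move=> xD x_neq0; apply: C1 (subC _ _ xD) _; rewrite mulmx_free_eq0.
  split=> [rkD|rkD|rkD].
  - have /rowV0Pn[x xD x_neq0] : D != 0 by rewrite -mxrank_eq0 -lt0n.
    by apply: leq_trans (word x xD x_neq0) (suppE _ _).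
  - have [V VD V_free] : exists2 V : 'M[F]_(2, n'), (V <= D)%MS & row_free V.
      by rewrite -rkD; exists (row_base D); rewrite ?eq_row_base ?row_base_free.
    apply: leq_trans (suppE _ V); apply: C2; first exact: subC.
    by rewrite /row_free mxrankMfree.
  - rewrite leqNgt; apply/negP => lt_n.
    have [||x [xD x_neq0 le_x]] := @singleton_word K F _ _ (m - 2) D.
    + exact: leq_subr.
    + by rewrite rkD subKn; lia.
    have := leq_trans (word x xD x_neq0) (leq_trans (supp_mulK x E) le_x); lia.
have [a1 a2 a3] := side _ D1 E1 E1_free D1C.
have [b1 b2 b3] := side _ D2 E2 E2_free D2C.
have rk12 : (\rank D1 + \rank D2 = 4)%N by rewrite -rkC12 rkC.
have {}a1 := a1 D1_gt0; have {}b1 := b1 D2_gt0.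
have : (\rank D1 = 1 \/ \rank D1 = 2 \/ \rank D1 = 3)%N by lia.
case=> [D1_1|[D1_2|D1_3]].
- have /b3 : \rank D2 = 3 by lia.
  lia.
- have := a2 D1_2; have /b2 : \rank D2 = 2 by lia.
  lia.
- have := a3 D1_3; lia.
Qed.

End DirectSums.

(** * Passing from a code to the system of its dual *)

Section Duality.

Variables (K : finFieldType) (F : fieldExtType K).
Local Notation toF := (map_mx (in_alg F)).
Local Notation m := (\dim {:F}).

(** An equivalence of systems relates the generator matrices by
    G' = A * sigma G * N with N invertible over K, so the dual codes are related
    by sigma and the inverse transpose of N. *)
Lemma system_equiv_code_equiv k r r' n (G : 'M[F]_(k, n)) (H : 'M[F]_(r, n))
    (D : 'M[F]_(r', n)) (U' : {vspace {ffun 'I_k -> F}}) :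
  G *m H^T = 0 -> (\rank G + \rank H)%N = n ->
  associated (dual_code D) U' -> system_equiv (qspan G) U' -> code_equiv H D.
Proof.
move=> GH rkGH [G' [[G'_free G'D] G'_indep ->]] [A [sigma [A_unit sigma_bij UU']]].
have [N G'E] : exists N : 'M[K]_n, G' = A *m map_mx sigma G *m toF N.
  apply: factor_columns => j.
  have /UU'[u /mem_qspan[v uE]] := col_qspan G' j; rewrite vcol_ffun => ->.
  have [w wE] := rmorph_toF sigma v^T; exists w^T.
  by rewrite uE map_mxM wE mulmxA trmxK.
have N_unit : N^T \in unitmx.
  rewrite -row_free_unit -kermx_eq0; apply/eqP/row_matrixP => i; rewrite row0.
  have [G'P _] := free_qcolsP G'; apply: G'P => //.
  have : row i (kermx N^T) *m N^T = 0 by apply/sub_kermxP/row_sub.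
  move/(congr1 trmx); rewrite trmx_mul trmxK trmx0 => Nv.
  by rewrite G'E -mulmxA -map_mxM Nv map_mx0 mulmx0.
have rkG' : \rank G' = (n - \rank D)%N by rewrite (eqmx_rank G'D) mxrank_ker mxrank_tr.
have G'D0 : G' *m D^T = 0 by apply/sub_kermxP; case/andP: G'D.
have DP := annihilatorP G'D0.
have {}DP (x : 'rV[F]_n) : (x <= D)%MS = (G' *m x^T == 0).
  by apply: DP; rewrite rkG' subnK // rank_leq_col.
have sGH : map_mx sigma G *m (map_mx sigma H)^T = 0.
  by rewrite map_trmx -map_mxM GH map_mx0.
have sHP := annihilatorP sGH.
have {}sHP (x : 'rV[F]_n) : (x <= map_mx sigma H)%MS = (map_mx sigma G *m x^T == 0).
  by apply: sHP; rewrite !mxrank_map.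
have [tau sK tK] := sigma_bij.
have tauK a b (w : 'M[F]_(a, b)) : map_mx sigma (map_mx tau w) = w.
  by apply/matrixP => i j; rewrite !mxE tK.
have NF_unit : toF N^T \in unitmx by rewrite map_unitmx.
have xD (x : 'rV[F]_n) : (x <= D)%MS = (x *m toF N^T <= map_mx sigma H)%MS.
  rewrite DP sHP trmx_mul map_trmx trmxK G'E -!mulmxA.
  apply/eqP/eqP => [/(congr1 (mulmx (invmx A)))|->]; last by rewrite mulmx0.
  by rewrite mulKmx // mulmx0.
exists (invmx N^T), sigma; split=> //; first by rewrite unitmx_inv.
move=> x; rewrite xD map_invmx; split=> [/submxP[w wE]|[c /submxP[w ->] ->]].
  exists (map_mx tau w *m H); first exact: submxMl.
  by rewrite map_mxM tauK -wE mulmxK.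
by rewrite mulmxKV // map_mxM submxMl.
Qed.

(** If h + 1 independent elements of the system lie in an h-dimensional subspace,
    the F-linear dependency between them is a nonzero word of the dual code that
    factors through h + 1 vectors over K, so that its weight is at most h + 1. *)
Lemma scattered_from_dual k r n h (G : 'M[F]_(k, n)) (H : 'M[F]_(r, n)) :
  G *m H^T = 0 -> (\rank G + \rank H)%N = n ->
  (forall x : 'rV[F]_n, (x <= H)%MS -> x != 0 -> (h.+1 < supp x)%N) ->
  scattered h (qspan G).
Proof.
move=> GH rkGH wt L rkL; rewrite leqNgt; apply/negP => lt_h.
set W := (_ :&: _)%VS in lt_h; pose w := vbasis W.
have wP (i : 'I_(\dim W)) : exists v : 'rV[K]_n,
    vcol w`_i = G *m toF v^T /\ (vrow w`_i <= L)%MS.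
  have : w`_i \in W by apply/vbasis_mem/mem_nth; rewrite size_tuple.
  by rewrite memv_cap mem_resK => /andP[/mem_qspan[v vE] wL]; exists v.
have {wP} /fin_all_exists[v vP] := wP.
pose N := \matrix_i v i; pose Gw := G *m toF N^T.
have GwE j i : Gw j i = (w`_i : {ffun 'I_k -> F}) j.
  transitivity ((G *m toF (v i)^T) j 0); last by rewrite -(vP i).1 mxE.
  by rewrite !mxE; apply: eq_bigr => l _; rewrite !mxE.
have N_free : row_free N.
  rewrite -kermx_eq0; apply/rowV0P => c /sub_kermxP cN.
  have w_free : free w := basis_free (vbasisP W).
  suff c0 : \sum_i c 0 i *: w`_i = 0.
    by apply/rowP => i; rewrite mxE; apply: (freeP w_free (fun i => c 0 i)).
  apply: vcol_inj; rewrite vcol0; transitivity (Gw *m toF c^T); last first.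
    by rewrite -mulmxA -map_mxM -trmx_mul cN trmx0 map_mx0 mulmx0.
  apply/colP => j; rewrite !mxE sum_ffunE; apply: eq_bigr => i _.
  by rewrite GwE ffunE !mxE mulrC mulr_algl.
have GwL : (Gw^T <= L)%MS.
  apply/row_subP => i; have := (vP i).2; congr (_ <= L)%MS.
  by apply/rowP => j; rewrite [RHS]mxE [RHS]mxE GwE mxE.
pose P : 'M[K]_(h.+1, \dim W) := pid_mx h.+1.
have PN_free : row_free (P *m N).
  by rewrite /row_free mxrankMfree // rank_pid_mx.
have /rowV0Pn[c /sub_kermxP cP c_neq0] : kermx (toF P *m Gw^T) != 0.
  rewrite kermx_eq0 /row_free neq_ltn ltnS; apply/orP; left.
  have /mxrankS : (toF P *m Gw^T <= L)%MS by apply: submx_trans (submxMl _ _) GwL.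
  by rewrite rkL.
pose x := c *m toF (P *m N).
have x_neq0 : x != 0 by rewrite mulmx_free_eq0 // /row_free mxrank_map.
have xH : (x <= H)%MS.
  rewrite (annihilatorP GH rkGH) -trmx_eq0 trmx_mul trmxK.
  move/eqP: cP; rewrite /Gw trmx_mul map_trmx trmxK.
  by rewrite /x map_mxM !mulmxA.
have := wt x xH x_neq0; apply/negP; rewrite -leqNgt.
exact: leq_trans (supp_mulK _ _) (supp_leq _).
Qed.

End Duality.

(** * Column reorderings and the matrix G_B *)

Section Assembly.

Lemma extend_to_bijection a k n (h : 'I_a -> 'I_n) : (a + k = n)%N -> injective h ->
  exists2 p : 'I_(a + k) -> 'I_n, bijective p & forall j, p (lshift k j) = h j.
Proof.
move=> en h_inj; pose S := ~: [set h j | j : 'I_a].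
have cardS : k = #|S|.
  by rewrite cardsCs setCK card_imset // !card_ord -en addKn.
pose p i := match split i with inl j => h j | inr l => enum_val (cast_ord cardS l) end.
exists p => [|j]; last by rewrite /p (unsplitK (inl j)).
apply: inj_card_bij; last by rewrite !card_ord en.
have nS j l : h j <> enum_val (cast_ord cardS l).
  move=> e; have := enum_valP (cast_ord cardS l).
  by rewrite -e in_setC => /imsetP[]; exists j.
move=> i i'; rewrite /p; case: split_ordP => j ->.
  by case: split_ordP => j' -> => [/h_inj ->|/nS].
by case: split_ordP => j' -> => [/esym/nS|/enum_val_inj/cast_ord_inj ->].
Qed.

Lemma ceil_ratio a n c : (0 < n)%N -> (c * n < a <= c.+1 * n)%N ->
  Num.ceil (a%:R / n%:R : rat) = c.+1%:Z.
Proof.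
move=> n_gt0 /andP[lt_a le_a]; apply: ceil_def.
have n_gt0' : 0 < n%:R :> rat by rewrite ltr0n.
rewrite ltr_pdivlMr // ler_pdivrMr //.
have -> : c.+1%:Z - 1 = c%:Z by rewrite -addn1 PoszD addrK.
by rewrite -!pmulrn -!natrM ltr_nat ler_nat lt_a le_a.
Qed.

Variables (K : finFieldType) (F : fieldExtType K).
Local Notation toF := (map_mx (in_alg F)).
Local Notation m := (\dim {:F}).

Lemma supp_le1 n (y : 'rV[F]_n) : (supp y <= 1)%N ->
  exists (c : F) (v : 'rV[K]_n), y = c *: toF v.
Proof.
rewrite supp_rowE => le1.
have [r [R [c [{}le1 yE]]]] : exists r (R : 'M[K]_(r, n)) (c : 'rV[F]_r),
    (r <= 1)%N /\ y = c *m toF R.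
  by have [c yE] := expand_factor y; do 3!eexists; split; [exact: le1|exact: yE].
case: r R c le1 yE => [|[|//]] R c _ ->.
  by exists 0, 0; rewrite scale0r [c]thinmx0 mul0mx.
by exists (c 0 0), R; rewrite {1}[c]mx11_scalar mul_scalar_mx.
Qed.

Lemma supp_toF n (v : 'rV[K]_n) : (supp (toF v) <= 1)%N.
Proof.
rewrite -[toF v]mul1mx; exact: leq_trans (supp_mulK _ _) (supp_leq _).
Qed.

(** A word of weight 1 is a multiple of a vector over K, which would be a
    K-relation between the columns of H; a word of weight 2 exists by counting. *)
Lemma dual_min_dist k r r' n (G : 'M[F]_(k, n)) (H : 'M[F]_(r, n)) (C : 'M[F]_(r', n)) :
  G *m H^T = 0 -> row_free G ->
  (forall v : 'rV[K]_n, H *m toF v^T = 0 -> v = 0) ->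
  (1 < m)%N -> ((m - 2) * n < k * m)%N ->
  associated C (qspan G) -> min_dist C = 2.
Proof.
move=> GH G_free H_indep m_gt1 lt_k [G' [[G'_free G'C] _ eGG']].
have rkC : \rank C = k by rewrite -(eqmx_rank G'C); apply/eqP.
have [A GE] := qspan_factor eGG'.
apply: min_dist_eq => [x xC x_neq0|].
  have /submxP[u xE] : (x <= G')%MS by case/andP: G'C => _; apply: submx_trans.
  have u_neq0 : u != 0 by apply: contraNneq x_neq0 => u0; rewrite xE u0 mul0mx.
  pose y := u *m G.
  have y_neq0 : y != 0 by rewrite mulmx_free_eq0.
  apply: leq_trans (_ : supp y <= _)%N; last first.
    by rewrite /y GE mulmxA -xE supp_mulK.
  rewrite leqNgt; apply: contra y_neq0 => /supp_le1[c [v yE]].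
  have : H *m y^T = 0.
    by apply: trmx_inj; rewrite trmx_mul trmxK trmx0 -mulmxA GH mulmx0.
  rewrite yE linearZ /= -scalemxAr map_trmx.
  have [->|c_neq0] := eqVneq c 0; first by rewrite !scale0r.
  move/eqP; rewrite scalemx_eq0 (negPf c_neq0) => /eqP/H_indep ->.
  by rewrite map_mx0 scaler0.
apply: singleton_word => //; by rewrite rkC.
Qed.

Lemma GB_mx_annihilates k (H : 'M[F]_(4, 4 + k)) : lsubmx H \in unitmx ->
  GB_mx H *m H^T = 0.
Proof.
move=> A_unit; rewrite /GB_mx -[in X in _ *m X](hsubmxK H) tr_row_mx mul_row_col.
by rewrite mul1mx mulNmx -mulmxA -trmx_mul mulmxV // trmx1 mulmx1 addNr.
Qed.

Lemma GB_mx_free k (H : 'M[F]_(4, 4 + k)) : row_free (GB_mx H).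
Proof.
by apply/row_freeP; exists (col_mx 0 1%:M); rewrite mul_row_col mulmx0 add0r mulmx1.
Qed.

Lemma colsub_mulK r n n' (p : 'I_n' -> 'I_n) (H : 'M[F]_(r, n)) :
  mxsub id p H = H *m toF (mxsub id p 1%:M).
Proof. by rewrite map_mxsub map_mx1 mulmx_colsub mulmx1. Qed.

Lemma colsub_inv n n' (p : 'I_n' -> 'I_n) : bijective p ->
  exists Q : 'M[K]_(n', n), mxsub id p 1%:M *m Q = 1%:M /\ Q *m mxsub id p 1%:M = 1%:M.
Proof.
case=> g gK pK; exists (mxsub id g 1%:M); rewrite !mulmx_colsub !mulmx1 -!mxsub_comp.
by split; apply: mxsub_eq_id => // i; rewrite /= ?gK ?pK.
Qed.

Lemma q_system_qspan k n (G : 'M[F]_(k, n)) :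
  row_free G -> free (qcols G) -> q_system (qspan G) n.
Proof.
move=> G_free G_indep; split.
  by have /eqP -> := G_indep; rewrite size_map size_enum_ord.
rewrite -col_leq_rank -[X in (X <= _)%N](eqP G_free) -mxrank_tr.
apply/mxrankS/row_subP => j; set U := qspan G.
have gU : [ffun i => G i j] \in U by apply: col_qspan.
have -> : row j G^T =
    \sum_i in_alg F (coord (vbasis U) i [ffun i => G i j]) *: row i (Fspan U).
  apply/rowP => i; have /ffunP/(_ i) := coord_vbasis gU; rewrite ffunE mxE mxE => {1}->.
  rewrite sum_ffunE summxE; apply: eq_bigr => l _.
  by rewrite ffunE !mxE mulr_algl.
by apply: summx_sub => i _; apply/scalemx_sub/row_sub.
Qed.

End Assembly.

(** * The code D_B *)

Section Construction.

Variables (K : finFieldType) (F : fieldExtType K).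
Local Notation toF := (map_mx (in_alg F)).
Local Notation m := (\dim {:F}).
Local Notation q := #|K|.
Variables (I J s k : nat) (alpha beta gamma : F).
Variables (xi : m.-tuple F) (B : {vspace F}) (b : s.-tuple F).
Hypotheses (neq_IJ : I <> J) (I_gt0 : (0 < I)%N) (J_gt0 : (0 < J)%N).
Hypotheses (ltIm : (I < m)%N) (ltJm : (J < m)%N).
Hypothesis gcd_IJm : gcdn (gcdn I J) m = 1%N.
Hypotheses (alpha_neq0 : alpha != 0) (beta_neq0 : beta != 0).
Hypothesis P_noroot : forall x, ~~ root (P_poly q I J alpha beta gamma) x.
Hypotheses (xi_basis : basis_of {:F} xi) (b_basis : basis_of B b).
Hypothesis m_gt1 : (1 < m)%N.
Local Notation H0 := (H0_mx q I J alpha beta gamma xi).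
Local Notation HB0 := (HB_mx q I J alpha beta gamma xi b).

Lemma H0_row_free : row_free H0.
Proof.
rewrite -kermx_eq0; apply/rowV0P => u /sub_kermxP uH; apply/eqP/negPn/negP => u_neq0.
have := supp_H0 neq_IJ ltIm ltJm gcd_IJm alpha_neq0 beta_neq0 P_noroot xi_basis u_neq0.
by rewrite uH supp0 leqn0 subn_eq0 leqNgt m_gt1.
Qed.

Lemma supp_HB1 (u : 'rV[F]_4) : u != 0 -> (m - 1 <= supp (u *m HB0))%N.
Proof.
move=> u_neq0; have := supp_H0 neq_IJ ltIm ltJm gcd_IJm alpha_neq0 beta_neq0 P_noroot
  xi_basis u_neq0.
move/leq_trans; apply.
have -> : u *m H0 = u *m HB0 *m toF (col_mx 1%:M 0).
  by rewrite map_col_mx map_mx1 map_mx0 -mulmxA mul_row_col mulmx1 mulmx0 addr0.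
exact: supp_mulK.
Qed.

(** The first two rows of H separate the two copies of the basis xi, and the
    third one then separates the basis of B. *)
Lemma HB0_columns_free (v : 'rV[K]_(m + m + s)) : HB0 *m toF v^T = 0 -> v = 0.
Proof.
have xi_free := freeP (basis_free xi_basis).
have b_free := freeP (basis_free b_basis).
pose v1 := lsubmx (lsubmx v); pose v2 := rsubmx (lsubmx v); pose v3 := rsubmx v.
have -> : v = row_mx (row_mx v1 v2) v3 by rewrite !hsubmxK.
move: v1 v2 v3 => v1 v2 v3 {v}.
rewrite !tr_row_mx !map_col_mx /HB_mx /H0_mx !mul_row_col => /colP Hv.
have v1_0 : v1 = 0.
  apply/rowP => j; rewrite [RHS]mxE; apply: (xi_free (v1 0)).
  have := Hv ord0; rewrite !mxE => e; rewrite -[RHS]e.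
  rewrite [X in _ = _ + X + _]big1 ?addr0 => [|i _]; last by rewrite !mxE mul0r.
  rewrite [X in _ = _ + X]big1 ?addr0 => [|i _]; last by rewrite !mxE mul0r.
  by apply: eq_bigr => i _; rewrite !mxE (tnth_nth 0) mulrC mulr_algl.
have v2_0 : v2 = 0.
  apply/rowP => j; rewrite [RHS]mxE; apply: (xi_free (v2 0)).
  have := Hv o1; rewrite !mxE => e; rewrite -[RHS]e.
  rewrite [X in _ = X + _ + _]big1 ?add0r => [|i _]; last by rewrite !mxE mul0r.
  rewrite [X in _ = _ + X]big1 ?addr0 => [|i _]; last by rewrite !mxE mul0r.
  by apply: eq_bigr => i _; rewrite !mxE (tnth_nth 0) mulrC mulr_algl.
have v3_0 : v3 = 0.
  apply/rowP => j; rewrite [RHS]mxE; apply: (b_free (v3 0)).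
  have := Hv o2; rewrite v1_0 v2_0 !trmx0 !map_mx0 !mulmx0 !addr0 add0r [RHS]mxE => e.
  rewrite -[RHS]e mxE.
  by apply: eq_bigr => i _; rewrite !mxE (tnth_nth 0) mulrC mulr_algl.
by rewrite v1_0 v2_0 v3_0 !row_mx0.
Qed.

Lemma admissible_exists : (4 + k = m + m + s)%N ->
  exists p : 'I_(4 + k) -> 'I_(m + m + s), admissible_reordering HB0 p.
Proof.
move=> def_k.
have H0_full : row_full H0^T by rewrite /row_full mxrank_tr; exact: H0_row_free.
pose h j := lshift s (fullrankfun H0_full j).
have h_inj : injective h by move=> j j' /lshift_inj/fullrankfun_inj.
have [p p_bij pE] := extend_to_bijection def_k h_inj.
exists p; split=> // [j|]; first by rewrite pE /= ltn_ord.
rewrite -unitmx_tr.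
suff -> : (lsubmx (mxsub id p HB0))^T = rowsub (fullrankfun H0_full) H0^T.
  exact: fullrowsub_unit.
apply/matrixP => i j.
by rewrite mxE [LHS]mxE [LHS]mxE pE /HB_mx /h row_mxEl [RHS]mxE [RHS]mxE.
Qed.

Variable p : 'I_(4 + k) -> 'I_(m + m + s).
Hypothesis p_bij : bijective p.
Local Notation HB := (mxsub id p HB0).

Lemma HB_inv : exists Q : 'M[K]_(4 + k, m + m + s),
  HB0 = HB *m toF Q /\ row_free Q.
Proof.
have [Q [PQ QP]] := colsub_inv K p_bij.
exists Q; split; last by apply/row_freeP; eexists; exact: QP.
by rewrite (colsub_mulK p) -mulmxA -map_mxM PQ map_mx1 mulmx1.
Qed.

Lemma HB_row_free : row_free HB.
Proof.
have [Q [HQ _]] := HB_inv.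
rewrite -kermx_eq0; apply/rowV0P => u /sub_kermxP uH; apply/eqP/negPn/negP => u_neq0.
have := supp_HB1 u_neq0.
by rewrite HQ mulmxA uH mul0mx supp0 leqn0 subn_eq0 leqNgt m_gt1.
Qed.

Lemma supp_HB_word (x : 'rV[F]_(4 + k)) :
  (x <= HB)%MS -> x != 0 -> (m - 1 <= supp x)%N.
Proof.
move=> /submxP[u ->] x_neq0; have [Q [HQ _]] := HB_inv.
apply: leq_trans (supp_mulK (u *m HB) Q); rewrite -mulmxA -HQ.
by apply: supp_HB1; apply: contraNneq x_neq0 => ->; rewrite mul0mx.
Qed.

Lemma supp_HB_plane (V : 'M[F]_(2, 4 + k)) :
  (V <= HB)%MS -> row_free V -> (2 * (m - maxn I J) <= supp V)%N.
Proof.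
move=> /submxP[u ->] V_free; have [Q [HQ _]] := HB_inv.
apply: leq_trans (supp_mulK (u *m HB) Q); rewrite -mulmxA -HQ.
apply: supp_HB2 => //.
by move: V_free; rewrite /row_free mxrankMfree // HB_row_free.
Qed.

Lemma HB_columns_free (v : 'rV[K]_(4 + k)) : HB *m toF v^T = 0 -> v = 0.
Proof.
rewrite colsub_mulK -mulmxA -map_mxM => Hv.
have [Q [PQ QP]] := colsub_inv K p_bij.
apply: trmx_inj; rewrite trmx0 -[v^T]mul1mx -QP -mulmxA.
have -> : mxsub id p 1%:M *m v^T = 0; last by rewrite mulmx0.
by apply: trmx_inj; rewrite trmx0; apply: HB0_columns_free; rewrite trmxK.
Qed.

End Construction.

(** * The system and its dual code *)

Theorem theorem4p2 (K : finFieldType) (F : fieldExtType K)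
    (q m I J s k : nat) (alpha beta gamma : F)
    (xi : m.-tuple F) (B : {vspace F}) (b : s.-tuple F)
    (card_K : #|K| = q) (dim_F : \dim {:F} = m)
    (neq_IJ : I <> J)
    (I_bounds : (1 <= I < m - 1)%N) (J_bounds : (1 <= J < m - 1)%N)
    (gcd_IJm : gcdn (gcdn I J) m = 1%N)
    (alpha_neq0 : alpha != 0) (beta_neq0 : beta != 0) (gamma_neq0 : gamma != 0)
    (P_noroot : forall x : F, ~~ root (P_poly q I J alpha beta gamma) x)
    (s_ge1 : (1 <= s)%N) (s_lt : (2 * s < m - 2)%N)
    (dim_B : \dim B = s)
    (xi_basis : basis_of {:F} xi) (b_basis : basis_of B b)
    (def_k : (4 + k = m + m + s)%N) :
  let HB0 := HB_mx q I J alpha beta gamma xi b in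
  (exists p : 'I_(4 + k) -> 'I_(m + m + s), admissible_reordering HB0 p) /\
  forall p : 'I_(4 + k) -> 'I_(m + m + s), admissible_reordering HB0 p ->
  let HB := colsub p HB0 in
  let GB := GB_mx HB in
  let U := qspan GB in
  let M := maxn I J in
  [/\ q_system U (2 * m + s) /\ extremal_scattered (m - 3) U,
      associated GB U /\ (HB == dual_code GB)%MS,
      [/\ nondeg_code HB, quasi_MRD HB & code_params HB 4 (m - 1)],
      (forall C : 'M[F]_(4 + k), associated C U ->
         [/\ nondeg_code C, quasi_MRD C
           & code_params C (2 * m + s - 4) 2])
    & (2 * M <= m - 1)%N ->
      (2 * (m - M) <= gen_weight 2 HB)%N /\ (m + 1 <= 2 * (m - M))%N /\
      ((m + s %/ 2 < 2 * (m - M))%N ->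
         (forall (s1 s2 : nat) (D : 'M[F]_(4 + k))
            (U' : {vspace {ffun 'I_k -> F}}),
            (s1 + s2)%N = s -> order_one_direct_sum s1 s2 D ->
            associated (dual_code D) U' -> ~ system_equiv U U')
         /\
         (forall C : 'M[F]_(4 + k),
            nontrivial_direct_sum C -> ~ code_equiv HB C))].
Proof.
subst q m; set m := \dim {:F} in xi xi_basis I_bounds J_bounds gcd_IJm s_lt def_k *.
have [I_gt0 J_gt0] : (0 < I)%N /\ (0 < J)%N by lia.
have [ltIm ltJm] : (I < m)%N /\ (J < m)%N by lia.
have m_gt1 : (1 < m)%N by lia.
have m3 : (m - 3).+2 = (m - 1)%N by lia.
have en : (4 + k = 2 * m + s)%N by lia.
have lt_mn : (m < 4 + k)%N by lia.
have ceil_HB : (1 * (4 + k) < m * 4 <= 2 * (4 + k))%N by lia.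
have em : exists d, m = (d + 3)%N by exists (m - 3)%N; lia.
have dim_k : (k * m = (4 + k) * (m - 3).+1 + 2 * s)%N.
  by case: em en => d -> en; rewrite addnK; nia.
have ceil_C : ((m - 2) * (4 + k) < m * k <= (m - 2).+1 * (4 + k))%N.
  by case: em en s_lt => d -> en lt_s; have -> : (d + 3 - 2 = d.+1)%N; nia.
have count_HB : ((m - (m - 1)) * (4 + k) < 4 * m)%N by rewrite subKn; lia.
have count_C : ((m - 2) * (4 + k) < k * m)%N.
  by rewrite [X in (_ < X)%N]mulnC; case/andP: ceil_C.
have small_s : (2 * s < (m - 3).+1)%N by lia.
have d_HB : m%:Z - 2%:Z - (m - 1)%N%:Z + 1 = 0 by lia.
have d_C : m%:Z - (m - 2).+1%:Z - 2%:Z + 1 = 0 by lia.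
have k_eq : k = (2 * m + s - 4)%N by lia.
have dM : (2 * maxn I J <= m - 1 -> m + 1 <= 2 * (m - maxn I J))%N by lia.
have m1 : ~~ (m - 1 <= 1)%N by lia.
move=> HB0; split; first by apply: admissible_exists.
move=> p [p_bij _ A_unit] HB GB U M.
have wt1 : forall x : 'rV[F]_(4 + k), (x <= HB)%MS -> x != 0 -> (m - 1 <= supp x)%N.
  by move=> x; apply: supp_HB_word.
have wt2 : forall V : 'M[F]_(2, 4 + k), (V <= HB)%MS -> row_free V ->
    (2 * (m - M) <= supp V)%N.
  by move=> V; apply: supp_HB_plane.
have HB_indep : forall v : 'rV[K]_(4 + k), HB *m map_mx (in_alg F) v^T = 0 -> v = 0.
  by move=> v; apply: (HB_columns_free xi_basis b_basis).
have HB_free : row_free HB by apply: HB_row_free.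
have rkHB : \rank HB = 4 := eqP HB_free.
have GB_free : row_free GB := GB_mx_free HB.
have GBHB : GB *m HB^T = 0 := GB_mx_annihilates A_unit.
have rkGBHB : (\rank GB + \rank HB)%N = (4 + k)%N by rewrite (eqP GB_free) rkHB addnC.
have GB_indep : free (qcols GB).
  apply/free_qcolsP => v Gv; apply/eqP; rewrite -(map_mx_eq0 (in_alg F)).
  have vH : (map_mx (in_alg F) v <= HB)%MS.
    by rewrite (annihilatorP GBHB rkGBHB) map_trmx Gv.
  apply: contraNT m1 => v_neq0; exact: leq_trans (wt1 _ vH v_neq0) (supp_toF F v).
have assoc : associated GB U by exists GB; split=> //; split=> //; rewrite submx_refl.
have min_HB : min_dist HB = (m - 1)%N.
  by apply: min_dist_eq => //; apply: singleton_word; rewrite ?leq_subr ?rkHB.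
have [dimU fullU] := q_system_qspan GB_free GB_indep.
split.
- split; first by split; rewrite // dimU en.
  split.
    by apply: (scattered_from_dual GBHB rkGBHB) => x xH x_neq0; rewrite m3; apply: wt1.
  by rewrite dimU dim_k divnMDl // divn_small ?addn0.
- split=> //; apply/andP; rewrite /dual_code.
  have HBP := annihilatorP GBHB rkGBHB.
  have HB_sub (x : 'rV[F]_(4 + k)) : (x <= HB)%MS = (x <= kermx GB^T)%MS.
    by rewrite HBP sub_kermx -[RHS]trmx_eq0 trmx_mul trmxK.
  by split; apply/rV_subP => x; rewrite HB_sub.
- split.
  + apply: (@associated_nondeg _ _ 4 _ _ HB); first by split=> //; rewrite submx_refl.
    exact/free_qcolsP.
  + by split=> //; rewrite min_HB rkHB (@ceil_ratio _ _ 1).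
  + by split.
- move=> C assocC; have [G' [G'C G'_indep _]] := assocC.
  have rkC : \rank C = k by rewrite -(eqmx_rank G'C.2); apply/eqP/G'C.1.
  have min_C : min_dist C = 2.
    exact: dual_min_dist GBHB GB_free HB_indep m_gt1 count_C assocC.
  split; first exact: associated_nondeg G'C G'_indep.
    by split=> //; rewrite min_C rkC (@ceil_ratio _ _ (m - 2)).
  by split=> //; rewrite rkC.
move=> le_M; split.
  have [V VH V_free] : exists2 V : 'M[F]_(2, 4 + k), (V <= HB)%MS & row_free V.
    exists (pid_mx 2 *m HB); first exact: submxMl.
    by rewrite /row_free mxrankMfree // rank_pid_mx.
  have [] := @min_natP (fun d => exists V : 'M[F]_(2, 4 + k),
    [/\ (V <= HB)%MS, row_free V & \rank (Rsupp V) = d]) (supp V).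
    by exists V.
  by case=> W [WH W_free eW] _; rewrite /gen_weight -eW; apply: wt2.
split; first exact: dM.
move=> lt_s2.
have no_sum (C : 'M[F]_(4 + k)) : nontrivial_direct_sum C -> ~ code_equiv HB C.
  exact: (no_direct_sum en s_lt rkHB wt1 wt2 lt_s2).
split=> // s1 s2 D U' es [D1 [D2 [[_ [D1_2 _]] [_ [D2_2 _]] sumD]]] assocD UU'.
apply: (no_sum D); last exact: system_equiv_code_equiv GBHB rkGBHB assocD UU'.
exists (m + s1)%N, (m + s2)%N, D1, D2; split=> //.
- by rewrite !addn_gt0 ltnW.
- by rewrite D1_2.
- by rewrite D2_2.
Qed.
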